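(* Let $d\ge1$, $R\ge1$, $\delta>0$, and let $\mathcal{P}\subseteq\mathcal{M}_R(\mathbb{R}^d)$ be a nonempty Borel set. Let $w:\mathbb{R}^d\times\{0,1,2,\dots\}\to\mathbb{R}$ be the associated value function and $F$ the associated operator on symmetric matrices (both defined in the context). Assumption A: there exist $\alpha>0$, $\sigma\in(0,1]$, $a>0$, $K>1$ and a solution $\Phi\in C^2(\mathbb{R}^d\times(0,\infty))$ of $$\partial_t\Phi+F(D^2\Phi)=0\quad\text{in }\mathbb{R}^d\times(0,\infty)$$ such that $\Phi>0$ in $\mathbb{R}^d\times(0,\infty)$; $\Phi(\sqrt{s}\,x,s\,t)=s^{-\alpha}\Phi(x,t)$ for all $s>0$, $x\in\mathbb{R}^d$, $t>0$; $\Phi(\cdot,1)\in C^{2,\sigma}(\mathbb{R}^d)$; and $\|\Phi(\cdot,1)\|_{C^{2,\sigma}(B_1(x))}\le K\exp(-a|x|^2)$ for every $x\in\mathbb{R}^d$. Assumption B(i): for every $r>0$ there exists $N_0(r)>1$ such that, for every integer $N\ge N_0(r)$, $$\inf\big\{w(x,N):|x|\le r\sqrt{N\log N}\big\}>0 .$$ Assumption B(ii): for every $r>1$ and every integer $n\ge1$ there exists $C(r,n)>1$ such that $w(x,n)\le C(r,n)\exp\big(-r|x|/\sqrt{n}\big)$ for every $x\in\mathbb{R}^d$. Then, with $\Phi$ as in Assumption A: (i) If Assumptions A and B(ii) hold, then $$\sup_{r>0}\ \limsup_{n\to\infty}\ \sup_{x\in B_{r\sqrt n}}\frac{w(x,n)}{\Phi(x,n)}<+\infty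 .$$ (ii) If Assumptions A and B(i) hold, then $$0<\inf_{r>0}\ \liminf_{n\to\infty}\ \inf_{x\in B_{r\sqrt n}}\frac{w(x,n)}{\Phi(x,n)} .$$
   Context: $B_r(x)$ is the open Euclidean ball in $\mathbb{R}^d$ of radius $r$ centered at $x$, $B_r=B_r(0)$, and $\overline B_r$ is the closure of $B_r$. For $R\ge1$, $\mathcal{M}_R(\mathbb{R}^d)$ is the set of Borel probability measures $\rho$ on $\mathbb{R}^d$ such that, with $X$ the canonical random variable on $\mathbb{R}^d$ with law $\rho$, $\mathbb{E}_\rho[X]=0$ and $\mathbb{P}_\rho[|X|\le R]=1$ (with the Borel structure of the weak topology). Value function: $w(x,0)=1$ if $x\in\overline B_\delta$ and $w(x,0)=0$ if $x\in\mathbb{R}^d\setminus\overline B_\delta$; inductively, for $n\ge0$, $$w(x,n+1)=\sup_{\rho\in\mathcal{P}}\mathbb{E}_\rho[w(x+X,n)] .$$ (Since $\mathcal{P}$ is Borel, each $w(\cdot,n)$ is universally measurable, so these expectations make sense.) Operator: for a real symmetric $d\times d$ matrix $M$, $$F(M)=-\tfrac12\sup_{\rho\in\mathcal{P}}\mathbb{E}_\rho[X\cdot MX] .$$ $D^2\Phi$ denotes the Hessian in the space variable $x$. $\|\cdot\|_{C^{2,\sigma}}$ is the usual Hölder norm (sup norms of derivatives up to order $2$ plus the $\sigma$-Hölder seminorm of the second derivatives). *)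

(* Defs.v *)
From HB Require Import structures.
From mathcomp Require Import all_boot all_order all_algebra.
From mathcomp Require Import all_classical all_reals all_analysis.
From mathcomp Require Import measurable_realfun.

Set Implicit Arguments.
Unset Strict Implicit.
Unset Printing Implicit Defensive.

Import Order.TTheory GRing.Theory Num.Theory.
Import numFieldNormedType.Exports.

Local Open Scope classical_set_scope.
Local Open Scope ring_scope.

(** Euclidean structure: the norm carried by ['rV[R]_d] in the library is the
    sup norm; it induces the same topology, but not the same balls. *)
Definition enorm (R : realType) (d : nat) (x : 'rV[R]_d) : R :=
  Num.sqrt (\sum_i x ord0 i ^+ 2).

Definition eball (R : realType) (d : nat) (x : 'rV[R]_d) (r : R) :
  set 'rV[R]_d := [set y | enorm (y - x) < r].

Definition borelRd (R : realType) (d : nat) :=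
  g_sigma_algebraType (@open 'rV[R]_d).

Definition Prob (R : realType) (d : nat) := probability (borelRd R d) R.

Definition expect (R : realType) (d : nat) (rho : Prob R d)
  (f : 'rV[R]_d -> R) : R := \int[rho]_x f x.

(** [expect rho f] is the library integral, which for [f >= 0] is the supremum
    of the integrals of the Borel simple functions below [f].  The next lemma
    says that for [f] measurable with respect to the completion of [rho], i.e.
    [f] squeezed between two Borel functions that agree [rho]-a.e., this is the
    integral of [f] against the completion.  In particular it is the usual
    expectation of nonnegative universally measurable functions. *)
Lemma expect_completion (R : realType) (d : nat) (rho : Prob R d)
    (f : 'rV[R]_d -> R) (g h : borelRd R d -> R) :
  measurable_fun setT g -> measurable_fun setT h ->
  (forall x, 0 <= g x) -> (forall x, g x <= f x) -> (forall x, f x <= h x) ->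
  {ae rho, forall x, g x = h x} -> expect rho f = \int[rho]_x g x.
Proof.
move=> mg mh g0 gf fh gh.
have f0 x : 0 <= f x by rewrite (le_trans (g0 x)).
have h0 x : 0 <= h x by rewrite (le_trans (f0 x)).
have mono (u v : borelRd R d -> R) : (forall x, 0 <= u x) ->
    (forall x, u x <= v x) ->
    (\int[rho]_x (u x)%:E <= \int[rho]_x (v x)%:E)%E.
  move=> u0 uv; have v0 x : 0 <= v x by rewrite (le_trans (u0 x)).
  rewrite !ge0_integralTE//; try by move=> x; rewrite lee_fin.
  apply: ereal_sup_le => _ [k ku <-]; exists k => // x.
  by rewrite (le_trans (ku x))// lee_fin.
rewrite /expect /Rintegral; congr fine; apply/eqP; rewrite eq_le.
apply/andP; split; last exact: mono.
rewrite [leRHS](_ : _ = \int[rho]_x (h x)%:E)%E; first exact: mono.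
apply: ge0_ae_eq_integral => //.
- by have /measurable_EFinP := mg.
- by have /measurable_EFinP := mh.
- by move=> x _; rewrite lee_fin.
- by move=> x _; rewrite lee_fin.
- by move: gh; apply: filterS => x /= -> _.
Qed.

Definition bcont (R : realType) (d : nat) :=
  {f : 'rV[R]_d -> R | continuous f /\ bounded_fun f}.

Definition weak_eval (R : realType) (d : nat) (rho : Prob R d) :
  prod_topology (fun _ : bcont R d => R) := fun f => expect rho (sval f).

Definition weak_topology_Prob (R : realType) (d : nat) :=
  initial_topology (@weak_eval R d).

Definition weak_borel (R : realType) (d : nat) (P : set (Prob R d)) : Prop :=
  <<s (@open (weak_topology_Prob R d)) >> P.

(* Centered Borel probability measures supported in the closed ball of radius
   [r]; [E[X] = 0] is stated coordinatewise. *)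
Definition Mset (R : realType) (d : nat) (r : R) : set (Prob R d) :=
  [set rho | (forall i, expect rho (fun x => x ord0 i) = 0) /\
             rho [set x | enorm x <= r] = 1%E].

(* Since [P] is nonempty and all its members are probability measures, the
   real [sup] below is taken over a nonempty subset of [0, 1]. *)
Fixpoint value (R : realType) (d : nat) (delta : R) (P : set (Prob R d))
    (n : nat) (x : 'rV[R]_d) : R :=
  if n is n'.+1 then
    sup [set expect rho (fun y => value delta P n' (x + y)) | rho in P]
  else \1_(closure (eball 0 delta)) x.

Definition Fop (R : realType) (d : nat) (P : set (Prob R d))
    (M : 'M[R]_d) : R :=
  - (2^-1 * sup [set expect rho (fun x => (x *m M *m x^T) ord0 ord0)
                | rho in P]).

(** [Ck k D f]: [f] is of class C^k on the open set [D] of the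
    finite-dimensional space [V].  In finite dimension, continuity of all
    directional derivatives is continuity of the differential. *)
Fixpoint Ck (R : realType) (V : normedModType R) (k : nat) (D : set V)
    (f : V -> R) : Prop :=
  if k is k'.+1 then
    (forall x, D x -> differentiable f x) /\ (forall v, Ck k' D ('D_v f))
  else forall x, D x -> {for x, continuous f}.

Definition pd (R : realType) (d : nat) (i : 'I_d) (f : 'rV[R]_d -> R) :
  'rV[R]_d -> R := 'D_(delta_mx ord0 i) f.

Definition hessian (R : realType) (d : nat) (f : 'rV[R]_d -> R)
  (x : 'rV[R]_d) : 'M[R]_d := \matrix_(i, j) pd j (pd i f) x.

Definition supnorm (R : realType) (d : nat) (D : set 'rV[R]_d)
  (f : 'rV[R]_d -> R) : \bar R := ereal_sup [set `|f x|%:E | x in D].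

Definition holder_seminorm (R : realType) (d : nat) (s : R)
    (D : set 'rV[R]_d) (f : 'rV[R]_d -> R) : \bar R :=
  ereal_sup [set (`|f p.1 - f p.2| / enorm (p.1 - p.2) `^ s)%:E
            | p in [set p | [/\ D p.1, D p.2 & p.1 != p.2]]].

(* Mixed derivatives are counted once per ordered pair (i, j). *)
Definition C2s_norm (R : realType) (d : nat) (s : R)
    (D : set 'rV[R]_d) (f : 'rV[R]_d -> R) : \bar R :=
  (supnorm D f + \sum_(i < d) supnorm D (pd i f)
   + \sum_(i < d) \sum_(j < d) supnorm D (pd j (pd i f))
   + \sum_(i < d) \sum_(j < d) holder_seminorm s D (pd j (pd i f)))%E.

(** Functions on space-time R^d x (0, oo) are total functions on R^d x R whose
    values at times [t <= 0] are irrelevant. *)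
Definition solves_pde (R : realType) (d : nat) (P : set (Prob R d))
    (Phi : 'rV[R]_d * R -> R) : Prop :=
  forall x t, 0 < t ->
    derive1 (fun s => Phi (x, s)) t
    + Fop P (hessian (fun y => Phi (y, t)) x) = 0.

Definition assumptionA (R : realType) (d : nat) (P : set (Prob R d))
    (Phi : 'rV[R]_d * R -> R) : Prop :=
  exists alpha sigma a K : R,
    [/\ 0 < alpha, 0 < sigma <= 1, 0 < a & 1 < K] /\
    [/\ Ck 2 [set z : 'rV[R]_d * R | 0 < z.2] Phi,
        solves_pde P Phi,
        forall x t, 0 < t -> 0 < Phi (x, t) &
        forall s x t, 0 < s -> 0 < t ->
          Phi (Num.sqrt s *: x, s * t) = s `^ (- alpha) * Phi (x, t)] /\
    [/\ Ck 2 setT (fun x => Phi (x, 1)),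
        (C2s_norm sigma setT (fun x => Phi (x, 1%R)) < +oo)%E &
        forall x, (C2s_norm sigma (eball x 1%R) (fun y => Phi (y, 1%R))
                   <= (K * expR (- a * enorm x ^+ 2))%:E)%E].

Definition assumptionBi (R : realType) (d : nat) (delta : R)
    (P : set (Prob R d)) : Prop :=
  forall r : R, 0 < r -> exists2 N0 : R, 1 < N0 &
    forall N : nat, N0 <= N%:R ->
      0 < inf [set value delta P N x
              | x in [set x | enorm x <= r * Num.sqrt (N%:R * ln N%:R)]].

Definition assumptionBii (R : realType) (d : nat) (delta : R)
    (P : set (Prob R d)) : Prop :=
  forall (r : R) (n : nat), 1 < r -> (1 <= n)%N -> exists2 C : R, 1 < C &
    forall x, value delta P n x <= C * expR (- r * enorm x / Num.sqrt n%:R).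

(* Main.v *)
(* By self-similarity [Phi (x, t) = t^-alpha phi (x / sqrt t)], and Taylor
   expansion in space together with the equation in time show that [Phi] solves
   the dynamic programming recursion up to an error
   [O (n^(-alpha - theta - 1) exp (- a |x|^2 / (4 n)))], with
   [theta = sigma / 2].  The functions
     [(1 -+ B n^-theta) Phi (x, n) +- M n^(-alpha - theta) exp (- b |x|^2 / n)]
   with [b] small are then exact super- and subsolutions of the recursion: where
   [|x|] is at most a multiple of [sqrt n], [Phi] is bounded below by a multiple
   of [n^-alpha] and the drift of [n^-theta] absorbs all errors; farther
   out, the Gaussian is a strict supersolution and absorbs the error of [Phi].
   Comparing with the value function from a large time [n0] on gives the two
   bounds, the correction terms being negligible in [B_(r sqrt n)].
   At time [n0] the upper comparison holds because the Gaussian step also bounds the value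
   function, which starts from a bounded set, by a Gaussian; the lower one
   because the subsolution is nonpositive for [|x| >= r sqrt (n0 log n0)] when
   [r] is large, while B(i) makes the value function positive elsewhere. *)

Require Import Defs.
From HB Require Import structures.
From mathcomp Require Import all_boot all_order all_algebra.
From mathcomp Require Import all_classical all_reals all_analysis.
From mathcomp Require Import measurable_realfun ring lra.

Set Implicit Arguments.
Unset Strict Implicit.
Unset Printing Implicit Defensive.

Import Order.TTheory GRing.Theory Num.Theory.
Import numFieldNormedType.Exports.

Local Open Scope classical_set_scope.
Local Open Scope ring_scope.

(** * Euclidean norm, dot product and compact balls *)

Section Euclidean.
Variables (R : realType) (d : nat).
Implicit Types (x y : 'rV[R]_d).

Definition dot x y : R := \sum_i x ord0 i * y ord0 i.

Lemma enorm_ge0 x : 0 <= enorm x.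
Proof. exact: sqrtr_ge0. Qed.

Lemma enorm_sqr x : enorm x ^+ 2 = \sum_i x ord0 i ^+ 2.
Proof. by rewrite sqr_sqrtr// sumr_ge0// => i _; rewrite sqr_ge0. Qed.

Lemma enormZ (c : R) x : enorm (c *: x) = `|c| * enorm x.
Proof.
rewrite /enorm -sqrtr_sqr -sqrtrM ?sqr_ge0// mulr_sumr; congr Num.sqrt.
by apply: eq_bigr => i _; rewrite mxE exprMn.
Qed.

Lemma coord_le_enorm x i : `|x ord0 i| <= enorm x.
Proof.
rewrite -sqrtr_sqr ler_wsqrtr// (bigD1 i)//= lerDl.
by rewrite sumr_ge0// => j _; rewrite sqr_ge0.
Qed.

Lemma enorm_sqrD x y : enorm (x + y) ^+ 2 =
  enorm x ^+ 2 + 2 * dot x y + enorm y ^+ 2.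
Proof.
rewrite !enorm_sqr /dot mulr_sumr -!big_split/=; apply: eq_bigr => i _.
by rewrite mxE; ring.
Qed.

(* The factor [d] makes Cauchy-Schwarz unnecessary. *)
Lemma dot_le x y : `|dot x y| <= d%:R * (enorm x * enorm y).
Proof.
rewrite (le_trans (ler_norm_sum _ _ _))//.
rewrite (@le_trans _ _ (\sum_(i < d) enorm x * enorm y))//; last first.
  by rewrite sumr_const card_ord mulr_natl.
by apply: ler_sum => i _; rewrite normrM ler_pM// coord_le_enorm.
Qed.

Lemma sum_continuous (I : Type) (T : topologicalType) (s : seq I)
    (f : I -> T -> R) :
  (forall i, continuous (f i)) -> continuous (fun t => \sum_(i <- s) f i t).
Proof.
move=> cf; elim: s => [|i s IH] t.
  by under eq_fun do rewrite big_nil; exact: cvg_cst.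
by under eq_fun do rewrite big_cons; exact: (cvgD (cf i t) (IH t)).
Qed.

Lemma enorm_continuous : continuous (@enorm R d).
Proof.
move=> x; apply: (@continuous_comp _ _ _ (fun x :
  'rV[R]_d => \sum_i x ord0 i ^+ 2)).
  apply: sum_continuous => i {}x; under eq_fun do rewrite expr2.
  have c : (fun y : 'rV[R]_d => y ord0 i) @ x --> x ord0 i.
    exact: coord_continuous.
  exact: (cvgM c c).
exact: sqrt_continuous.
Qed.

Lemma dot_continuous x : continuous (dot x).
Proof.
apply: sum_continuous => i y.
have c : (fun y : 'rV[R]_d => y ord0 i) @ y --> y ord0 i.
  exact: coord_continuous.
exact: (cvgM (cvg_cst _) c).
Qed.

Lemma closed_eball_closed (r : R) : closed [set x : 'rV[R]_d | enorm x <= r].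
Proof.
rewrite (_ : mkset _ = @enorm R d @^-1` [set y | y <= r])//.
by apply: closed_comp => [x _|]; [exact: enorm_continuous|exact: closed_le].
Qed.

Lemma closed_eball_compact (r : R) : compact [set x : 'rV[R]_d | enorm x <= r].
Proof.
apply: bounded_closed_compact; last exact: closed_eball_closed.
exists r; split; [exact: num_real|move=> M rM x /= xr];
  rewrite (le_trans _ (ltW rM))//.
rewrite (le_trans _ xr)//.
(* Boundedness refers to the sup norm, which, when nonzero, is the absolute value of some
   coordinate. *)
have [x0|/mx_norm_neq0[[i j] /= xij]] := eqVneq (mx_norm x) 0.
  by rewrite [leLHS]x0 enorm_ge0.
by rewrite [leLHS]xij ord1 coord_le_enorm.
Qed.

Lemma closure_eball_sub (r : R) x : closure (eball 0 r) x -> enorm x <= r.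
Proof.
move=> xr; apply: (@closed_eball_closed r); move: xr; apply: closure_subset.
by move=> y; rewrite /eball/= subr0 => /ltW.
Qed.

Lemma continuous_translate (f : 'rV[R]_d -> R) x :
  continuous f -> continuous (fun y => f (x + y)).
Proof.
move=> cf y; apply: (@continuous_comp _ _ _ (fun y => x + y)); last exact: cf.
exact: (cvgD (cvg_cst _) cvg_id).
Qed.

(** Meant for the profile [Phi (x, 1)]: after scaling it bounds [Phi (x, s)] below by a multiple of
    [s^-alpha] where [|x| <= r sqrt s]. *)
Lemma compact_pos_lbound (f : 'rV[R]_d -> R) (r : R) : 0 <= r -> continuous f ->
  (forall x, 0 < f x) -> exists2 c : R, 0 < c & forall x, enorm x <= r ->
    c <= f x.
Proof.
move=> r0 cf f0.
have [||c _ cmin] := @compact_EVT_min _ R f _ _ (@closed_eball_compact r).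
- by exists 0; rewrite /= /enorm big1 ?sqrtr0// => i _; rewrite mxE expr0n.
- exact: continuous_subspaceT.
by exists (f c) => // x xr; apply: cmin; rewrite inE.
Qed.

End Euclidean.

(** * Expectation: monotonicity, and linearity on continuous functions *)

Section Expectation.
Variables (R : realType) (d : nat).
Implicit Types (rho : Prob R d) (f g : 'rV[R]_d -> R).

Lemma continuous_borel f : continuous f ->
  measurable_fun setT (f : borelRd R d -> R).
Proof.
move=> cf; apply: (measurability (RGenOInfty.G (R:=R))).
  exact: RGenOInfty.measurableE.
move=> _ [_ [a ->] <-]; rewrite setTI; apply: sub_sigma_algebra.
have [+ _] := continuousP f; apply => //; exact: interval_open.
Qed.

Lemma borel_closed_eball (r : R) :
  measurable ([set x | enorm x <= r] : set (borelRd R d)).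
Proof.
rewrite -[X in measurable X]setCK; apply: measurableC.
by apply: sub_sigma_algebra; rewrite openC; exact: closed_eball_closed.
Qed.

(** For a nonnegative integrand the integral is a supremum over the simple functions below it, and a
    larger integrand admits more of them. *)
Lemma le_lower_integral rho f g : (forall x, 0 <= f x) ->
  (forall x, f x <= g x) ->
  (\int[rho]_x (f x)%:E <= \int[rho]_x (g x)%:E)%E.
Proof.
move=> f0 fg; have g0 x : 0 <= g x by rewrite (le_trans (f0 x)).
rewrite !ge0_integralTE//; try by move=> x; rewrite lee_fin.
apply: ereal_sup_le => _ [k kf <-]; exists k => // x.
by rewrite (le_trans (kf x))// lee_fin.
Qed.

Lemma integral_prob_cst rho (C : R) : (\int[rho]_x C%:E = C%:E)%E.
Proof. by rewrite integral_cst// [X in (_ * X)%E]probability_setT mule1. Qed.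

Lemma bounded_lower_integral_fin rho f (C : R) : (forall x, 0 <= f x <= C) ->
  (\int[rho]_x (f x)%:E)%E \is a fin_num.
Proof.
move=> fC; rewrite ge0_fin_numE; last first.
  by apply: integral_ge0 => x _; rewrite lee_fin; case/andP: (fC x).
apply: (@le_lt_trans _ _ (\int[rho]_x C%:E)%E).
  by apply: le_lower_integral => x; case/andP: (fC x).
by rewrite integral_prob_cst ltry.
Qed.

(* No measurability is assumed here: this is what makes the comparison
   arguments apply to the value function. *)
Lemma le_expect_lower rho f g (C : R) : (forall x, 0 <= f x) ->
  (forall x, f x <= g x) -> (forall x, g x <= C) ->
  expect rho f <= expect rho g.
Proof.
move=> f0 fg gC; have g0 x : 0 <= g x by rewrite (le_trans (f0 x)).
apply: fine_le; last exact: le_lower_integral.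
- apply: (@bounded_lower_integral_fin _ _ C) => x.
  by rewrite f0 (le_trans (fg x)).
- by apply: (@bounded_lower_integral_fin _ _ C) => x; rewrite g0 gC.
Qed.

Lemma expect_cst rho (C : R) : expect rho (fun=> C) = C.
Proof. by rewrite /expect /Rintegral integral_prob_cst. Qed.

Lemma expect_ge0 rho f : (forall x, 0 <= f x) -> 0 <= expect rho f.
Proof.
by move=> f0; apply: fine_ge0; apply: integral_ge0 => x _; rewrite lee_fin.
Qed.

Section BoundedSupport.
Variables (rad : R) (rho : Prob R d).
Hypothesis rhoM : rho [set x | enorm x <= rad] = 1%E.
Let D : set (borelRd R d) := [set x | enorm x <= rad].

Let mD : measurable D.
Proof. exact: borel_closed_eball. Qed.

Let rhoDC : rho (~` D) = 0%E.
Proof. by rewrite probability_setC// rhoM subee. Qed.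

Lemma continuous_bounded_closed_eball f : continuous f ->
  exists C : R, forall x, enorm x <= rad -> `|f x| <= C.
Proof.
move=> cf; have [|C [_ /(_ (C + 1))]] := @compact_bounded R _ (f @` D).
  apply: continuous_compact; last exact: closed_eball_compact.
  exact: continuous_subspaceT.
rewrite ltrDl ltr01 => /(_ isT) fC; exists (C + 1) => x xr.
by apply: fC; exists x.
Qed.

Let integrableD f : continuous f -> rho.-integrable D (EFin \o f).
Proof.
move=> cf; apply: measurable_bounded_integrable => //.
- by rewrite (le_lt_trans (probability_le1 _ _))// ltry.
- by apply: measurable_funTS; exact: continuous_borel.
- have [C fC] := continuous_bounded_closed_eball cf.
  exists C; split=> [|M CM x /= /fC /le_trans]; first exact: num_real.
  by apply; exact: ltW.
Qed.

(** The complement of the ball is negligible, so a continuous function, even if unbounded on the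
    whole space, has the expectation of its bounded restriction to [D]. Linearity and comparison on
    the support reduce to integrals over [D]. *)
Let expectD f : continuous f -> expect rho f = \int[rho]_(x in D) f x.
Proof.
move=> cf; rewrite /expect /Rintegral; congr fine.
have mf : measurable_fun setT (EFin \o f : borelRd R d -> \bar R).
  by apply/measurable_EFinP; exact: continuous_borel.
have DC : setT `\` ~` D = D by rewrite setDE setCK setTI.
rewrite (@negligible_integral _ _ _ _ _ (~` D))//.
- by rewrite DC.
- exact: measurableC.
- apply/integrableP; split => //.
  rewrite (@ge0_negligible_integral _ _ _ _ _ (~` D))//.
  + by rewrite DC; have /integrableP[] := integrableD cf.
  + exact: measurableC.
  + exact: measurableT_comp.
Qed.

Lemma expect_add f g : continuous f -> continuous g ->
  expect rho (fun x => f x + g x) = expect rho f + expect rho g.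
Proof.
move=> cf cg; rewrite !expectD//; first by apply: RintegralD => //;
  exact: integrableD.
by move=> x; exact: (cvgD (cf x) (cg x)).
Qed.

Lemma expect_scale (c : R) f : continuous f ->
  expect rho (fun x => c * f x) = c * expect rho f.
Proof.
move=> cf; rewrite !expectD//; first by apply: RintegralZl => //;
  exact: integrableD.
by move=> x; exact: (cvgM (cvg_cst _) (cf x)).
Qed.

Lemma expect_sum (I : Type) (s : seq I) (f : I -> 'rV[R]_d -> R) :
  (forall i, continuous (f i)) ->
  expect rho (fun x => \sum_(i <- s) f i x) = \sum_(i <- s) expect rho (f i).
Proof.
move=> cf; elim: s => [|i s IH].
  under eq_fun do rewrite big_nil; rewrite big_nil; exact: expect_cst.
under eq_fun do rewrite big_cons; rewrite big_cons -IH.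
by apply: expect_add => //; exact: sum_continuous.
Qed.

Lemma le_expect f g : continuous f -> continuous g ->
  (forall x, enorm x <= rad -> f x <= g x) -> expect rho f <= expect rho g.
Proof.
by move=> cf cg fg; rewrite !expectD//; apply: le_Rintegral => //;
  exact: integrableD.
Qed.

End BoundedSupport.

End Expectation.

(** * Gaussian one-step estimate and comparison for the value function *)

(** Under a centered law a linear [u] has mean zero, so averaging [expR u] costs only an exponential
    of second order. For [u <= 1/2] use [expR u <= 1 / (1 - u)] and [(1 + u + 2 u^2) (1 - u) = 1 +
    u^2 (1 - 2 u)]; for larger [u], [u <= 2 u^2]. *)
Lemma expR_le_add_expR_sqr (R : realType) (u : R) :
  expR u <= u + expR (2 * u ^+ 2).
Proof.
have [u2|u2] := leP u 2^-1; last first.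
  rewrite (@le_trans _ _ (expR (2 * u ^+ 2)))//; last by rewrite lerDr; lra.
  by rewrite ler_expR; nra.
have e1 : expR u * (1 - u) <= 1.
  have := expR_ge1Dx (- u); rewrite -(@ler_pM2l _ (expR u)) ?expR_gt0//.
  by rewrite expRxMexpNx_1.
have e2 := expR_ge1Dx (2 * u ^+ 2).
apply: (@le_trans _ _ (1 + u + 2 * u ^+ 2)); last lra.
rewrite -(@ler_pM2r _ (1 - u)); last lra.
by rewrite (le_trans e1)//; nra.
Qed.

(** The heat-kernel shape without its time prefactor; the barriers supply a power of the time
    instead. *)
Definition gauss (R : realType) (d : nat) (b s : R) (x : 'rV[R]_d) : R :=
  expR (- (b * enorm x ^+ 2 / s)).

Section Value.
Variables (R : realType) (d : nat) (rad delta : R) (P : set (Prob R d)).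
Implicit Types (x y : 'rV[R]_d) (f u : 'rV[R]_d -> R).

Lemma gauss_continuous (b s : R) : continuous (@gauss R d b s).
Proof.
move=> x; apply: (@continuous_comp _ _ _ (fun x :
  'rV[R]_d => - (b * enorm x ^+ 2 / s)));
  last exact: continuous_expR.
have c := @enorm_continuous R d x.
exact: (cvgN (cvgM (cvgM (cvg_cst _) (cvgM c c)) (cvg_cst _))).
Qed.

Lemma expect_dot rho x : Mset rad rho -> expect rho (dot x) = 0.
Proof.
move=> [rho0 rhoM]; have c i : continuous (fun y : 'rV[R]_d => y ord0 i).
  by move=> y; exact: coord_continuous.
rewrite /dot (expect_sum rhoM).
  rewrite big1// => i _; rewrite (expect_scale rhoM)// rho0 mulr0//.
by move=> i y; exact: (cvgM (cvg_cst _) (c i y)).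
Qed.

(** Expanding [|x + y|^2] gives [gauss b s x] times [expR u], with [u] linear in [y], times a factor
    at most 1. The linear term averages to zero and leaves an exponent of at most
    [b |x|^2 / (4 s^2)], by the smallness of [b]. Moving from time [s] to [s + 1] releases
    [b |x|^2 / (s (s + 1))], at least twice that amount: one share pays for the averaging, the other
    is the last factor on the right. *)
Lemma expect_gauss_le rho x (b s : R) : Mset rad rho -> 0 < b ->
  32 * b * (d%:R * rad) ^+ 2 <= 1 -> 1 <= s ->
  expect rho (fun y => gauss b s (x + y)) <=
  gauss b (s + 1) x * expR (- (b * enorm x ^+ 2 / (4 * s ^+ 2))).
Proof.
move=> rhoP b0 bd s1; have [rho0 rhoM] := rhoP.
have s0 : 0 < s by rewrite (lt_le_trans ltr01).
pose u y := - (2 * b / s) * dot x y.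
(* By [dot_le], [c] bounds [2 * u y ^+ 2] on the support. *)
pose c := 8 * b ^+ 2 * (d%:R * rad) ^+ 2 * enorm x ^+ 2 / s ^+ 2.
have cu : continuous u.
  by move=> y; exact: (cvgM (cvg_cst _) (@dot_continuous R d x y)).
have cuc : continuous (fun y => u y + expR c).
  by move=> y; exact: (cvgD (cu y) (cvg_cst _)).
rewrite (@le_trans _ _ (expect rho (fun y => gauss b s x * (u y + expR c))))//.
  apply: (le_expect rhoM).
  - exact: continuous_translate (@gauss_continuous b s).
  - by move=> y; exact: (cvgM (cvg_cst _) (cuc y)).
  move=> y yr.
  have -> : gauss b s (x + y) = gauss b s x * expR (u y) * gauss b s y.
    by rewrite /gauss /u -!expRD enorm_sqrD; congr expR; field; rewrite gt_eqF.
  rewrite (@le_trans _ _ (gauss b s x * expR (u y)))//.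
    rewrite ler_piMr//; first by rewrite mulr_ge0 ?expR_ge0.
    rewrite /gauss -[leRHS]expR0 ler_expR oppr_le0.
    by rewrite divr_ge0 ?mulr_ge0 ?enorm_ge0 ?ltW.
  rewrite ler_pM2l ?expR_gt0// (le_trans (expR_le_add_expR_sqr _))// lerD2l.
  rewrite ler_expR /u /c exprMn sqrrN.
  have : dot x y ^+ 2 <= (d%:R * (enorm x * rad)) ^+ 2.
    rewrite -real_normK ?num_real// ler_sqr ?nnegrE//.
      by rewrite (le_trans (dot_le _ _))// ler_wpM2l// ler_wpM2l// enorm_ge0.
    by rewrite !mulr_ge0 ?enorm_ge0// (le_trans (enorm_ge0 y)).
  move=> /(ler_wpM2l (_ : 0 <= 8 * b ^+ 2 / s ^+ 2)) h.
  rewrite [leLHS](_ : _ = 8 * b ^+ 2 / s ^+ 2 * dot x y ^+ 2); last first.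
    by field; rewrite gt_eqF.
  rewrite (le_trans (h _))//; first by rewrite divr_ge0 ?sqr_ge0//
    mulr_ge0 ?sqr_ge0.
  by rewrite le_eqVlt; apply/orP; left; apply/eqP; field; rewrite gt_eqF.
rewrite (expect_scale rhoM)// (expect_add rhoM)//; last exact: cst_continuous.
rewrite expect_cst (expect_scale rhoM); last exact: dot_continuous.
rewrite expect_dot// mulr0 add0r /gauss -!expRD ler_expR.
have -> : c = (32 * b * (d%:R * rad) ^+ 2) * (b * enorm x ^+ 2 / (4 * s ^+ 2)).
  by rewrite /c; field; rewrite gt_eqF.
have q0 : 0 <= b * enorm x ^+ 2 by rewrite mulr_ge0 ?sqr_ge0 ?ltW.
apply: (@le_trans _ _ (- (b * enorm x ^+ 2 / s) + b * enorm x ^+ 2 / (4 *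
  s ^+ 2))).
  rewrite lerD2l ler_piMl// divr_ge0// mulr_ge0// sqr_ge0//.
move: (b * _) q0 => q q0.
rewrite -subr_ge0.
rewrite [X in 0 <= X](_ : _ = q * (s - 1) / (2 * s ^+ 2 * (s + 1))).
  have s2 : 0 <= s - 1 by lra.
  have s3 : 0 <= s + 1 by lra.
  by rewrite divr_ge0 ?mulr_ge0 ?(ltW s0).
by field; rewrite !gt_eqF//; lra.
Qed.

Section Comparison.
Hypothesis P0 : P !=set0.

Lemma value_ge0 n x : 0 <= value delta P n x.
Proof.
elim: n x => [|n IH] x /=; first by rewrite indicE.
have [rho Prho] := P0.
(* Boundedness of this set comes later and relies on nonnegativity; were the set unbounded, [sup]
   would take its default value 0. *)
have [hu|hu] := pselect (has_ubound [set expect rho (fun y => value delta P n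
  (x + y)) | rho in P]).
  apply: le_trans (ub_le_sup hu (imageP _ Prho)).
  by apply: expect_ge0.
by rewrite sup_out// => -[].
Qed.

Lemma value_le1 n x : value delta P n x <= 1.
Proof.
elim: n x => [|n IH] x /=; first by rewrite indicE; case: (_ \in _).
apply: ge_sup; first by have [rho Prho] := P0;
  exists (expect rho (fun y => value delta P n (x + y))), rho.
move=> _ [rho Prho <-]; rewrite -(expect_cst rho 1).
by apply: (@le_expect_lower _ _ _ _ _ 1) => // y; exact: value_ge0.
Qed.

(** Supersolution half of the comparison: domination by a barrier passes to the next time. The bound
    [C] keeps the integral of [u] finite, as an infinite one would be sent to 0. *)
Lemma value_succ_le n x u (C v : R) : (forall y, value delta P n y <= u y) ->
  (forall y, u y <= C) ->
  (forall rho, P rho -> expect rho (fun y => u (x + y)) <= v) ->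
  value delta P n.+1 x <= v.
Proof.
move=> vu uC uv /=; apply: ge_sup.
  by have [rho Prho] := P0; exists (expect rho (fun y => value delta P n (x +
    y))), rho.
move=> _ [rho Prho <-]; apply: le_trans (uv _ Prho).
by apply: (@le_expect_lower _ _ _ _ _ C) => // y; exact: value_ge0.
Qed.

Hypothesis PM : P `<=` Mset rad.

(** Subsolution half of the comparison; one law is enough because the value is a supremum. As [u]
    may be negative while [le_expect_lower] compares nonnegative functions, the proof passes through
    the positive part [u'], which still lies below the value function. *)
Lemma value_succ_ge n x u rho : P rho -> continuous u ->
  (forall y, u y <= value delta P n y) ->
  expect rho (fun y => u (x + y)) <= value delta P n.+1 x.
Proof.
move=> Prho cu uv; have [_ rhoM] := PM Prho.
pose u' y := Num.max (u y) 0.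
have cu' : continuous u'.
  by move=> y; apply: (@continuous_max _ _ u (fun=> 0));
    [exact: cu|exact: cst_continuous].
rewrite (@le_trans _ _ (expect rho (fun y => u' (x + y))))//.
  apply: (le_expect rhoM); try exact: continuous_translate.
  by move=> y _; rewrite /u' le_max lexx.
rewrite (@le_trans _ _ (expect rho (fun y => value delta P n (x + y))))//.
  apply: (@le_expect_lower _ _ _ _ _ 1) => y.
  - by rewrite /u' le_max lexx orbT.
  - by rewrite /u' ge_max uv value_ge0.
  - exact: value_le1.
apply: ub_le_sup; last by exists rho.
exists 1 => _ [r Pr <-]; rewrite -(expect_cst r 1).
by apply: (@le_expect_lower _ _ _ _ _ 1) => // y;
  [exact: value_ge0|exact: value_le1].
Qed.

(** Starts the upper comparison. The factor [expR (b * delta ^+ 2)] makes the Gaussian at least 1 on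
    the initial ball, and the time is shifted by one because [expect_gauss_le] starts at time 1. *)
Lemma value_le_gauss (b : R) n x : 0 < b -> 32 * b * (d%:R * rad) ^+ 2 <= 1 ->
  value delta P n x <= expR (b * delta ^+ 2) * gauss b n.+1%:R x.
Proof.
move=> b0 bd; elim: n x => [|n IH] x.
  rewrite /= indicE; case: (boolP (_ \in _)) => [|_]; last first.
    by rewrite mulr_ge0// expR_ge0.
  rewrite inE => /closure_eball_sub xd.
  rewrite /gauss -expRD divr1 -[leLHS]expR0 ler_expR subr_ge0.
  by rewrite ler_pM2l// ler_pXn2r// ?nnegrE ?enorm_ge0// (le_trans _ xd)//
    enorm_ge0.
apply: (value_succ_le (u := fun y => expR (b * delta ^+ 2) * gauss b n.+1%:R y)
  (C := expR (b * delta ^+ 2))) => //.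
  move=> y; rewrite ler_piMr ?expR_ge0// /gauss -[leRHS]expR0 ler_expR oppr_le0.
  by rewrite divr_ge0// mulr_ge0// ?sqr_ge0// ltW.
move=> rho /PM Prho; have [_ rhoM] := Prho.
rewrite (expect_scale rhoM); last exact: continuous_translate
  (@gauss_continuous _ _).
rewrite ler_pM2l ?expR_gt0// (le_trans (expect_gauss_le _ Prho _ _ _))//.
  by rewrite ler1n.
rewrite natr1 ler_piMr ?expR_ge0// -[leRHS]expR0 ler_expR oppr_le0.
by rewrite divr_ge0 ?mulr_ge0 ?enorm_ge0 ?(ltW b0).
Qed.

End Comparison.

(** * The operator as a Lipschitz function of the matrix *)

Definition quad (M : 'M[R]_d) x : R := (x *m M *m x^T) ord0 ord0.

(** [Fop P M] is [- (2^-1 * quad_sup M)]. *)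
Definition quad_sup (M : 'M[R]_d) : R := sup [set expect rho (quad M) | rho in
  P].

Lemma quadE M x : quad M x = \sum_i \sum_j x ord0 i * M i j * x ord0 j.
Proof.
rewrite /quad mxE exchange_big/=; apply: eq_bigr => j _.
by rewrite !mxE mulr_suml.
Qed.

Lemma quad_continuous M : continuous (quad M).
Proof.
have c i : continuous (fun y : 'rV[R]_d => y ord0 i).
  by move=> y; exact: coord_continuous.
rewrite (_ : quad M = fun x => \sum_i \sum_j x ord0 i * M i j * x ord0 j);
  last first.
  by apply/funext => x; rewrite quadE.
apply: sum_continuous => i; apply: sum_continuous => j x.
exact: (cvgM (cvgM (c i x) (cvg_cst _)) (c j x)).
Qed.

Lemma quad_dist M N x (r : R) : enorm x <= r ->
  `|quad M x - quad N x| <= r ^+ 2 * \sum_i \sum_j `|M i j - N i j|.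
Proof.
move=> xr; rewrite !quadE -sumrB mulr_sumr.
rewrite (le_trans (ler_norm_sum _ _ _))//; apply: ler_sum => i _.
rewrite -sumrB mulr_sumr (le_trans (ler_norm_sum _ _ _))//;
  apply: ler_sum => j _.
rewrite (_ : _ - _ = x ord0 i * x ord0 j * (M i j - N i j)); last by ring.
rewrite !normrM ler_wpM2r// expr2 ler_pM// (le_trans (coord_le_enorm _ _))//.
Qed.

Hypothesis P0 : P !=set0.
Hypothesis PM : P `<=` Mset rad.

Lemma expect_quad_le rho M N : P rho ->
  expect rho (quad M) <= expect rho (quad N) + rad ^+ 2 *
    \sum_i \sum_j `|M i j - N i j|.
Proof.
move=> /PM[_ rhoM].
rewrite -[X in _ + X](expect_cst rho) -(expect_add rhoM).
- apply: (le_expect rhoM) => [||x xr].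
  + exact: quad_continuous.
  + by move=> x; exact: (cvgD (@quad_continuous N x) (cvg_cst _)).
  + by rewrite -lerBlDl (le_trans (ler_norm _))// quad_dist.
- exact: quad_continuous.
- exact: cst_continuous.
Qed.

Let quad0 rho : expect rho (quad 0) = 0.
Proof.
rewrite -[RHS](expect_cst rho); congr expect; apply/funext => x.
by rewrite /quad mulmx0 mul0mx mxE.
Qed.

Lemma expect_le_quad_sup rho M : P rho -> expect rho (quad M) <= quad_sup M.
Proof.
move=> Prho; apply: ub_le_sup; last by exists rho.
exists (rad ^+ 2 * \sum_i \sum_j `|M i j - (0 : 'M[R]_d) i j|) => _ [r Pr <-].
by rewrite (le_trans (expect_quad_le M 0 Pr))// quad0 add0r.
Qed.

Lemma quad_sup_le M N :
  quad_sup M <= quad_sup N + rad ^+ 2 * \sum_i \sum_j `|M i j - N i j|.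
Proof.
apply: ge_sup; first by have [rho Prho] := P0;
  exists (expect rho (quad M)), rho.
move=> _ [rho Prho <-]; rewrite (le_trans (expect_quad_le M N Prho))//.
by rewrite lerD2r expect_le_quad_sup.
Qed.

(** Through this Lipschitz bound the decay and the Hoelder regularity of the Hessian of the profile
    pass to the operator. *)
Lemma quad_sup_dist M N :
  `|quad_sup M - quad_sup N| <= rad ^+ 2 * \sum_i \sum_j `|M i j - N i j|.
Proof.
rewrite ler_distl quad_sup_le andbT lerBlDr.
rewrite (le_trans (quad_sup_le N M))// lerD2l ler_wpM2l ?sqr_ge0//.
by apply: ler_sum => i _; apply: ler_sum => j _; rewrite distrC.
Qed.

Lemma quad_sup0 : quad_sup 0 = 0.
Proof.
rewrite /quad_sup (_ : [set _ | _ in _] = [set 0]) ?sup1//.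
have [r Pr] := P0.
by apply/seteqP; split => [_ [rho Prho <-]|_ ->] /=; [rewrite quad0|exists r].
Qed.

Lemma quad_sup_norm_le M :
  `|quad_sup M| <= rad ^+ 2 * \sum_i \sum_j `|M i j|.
Proof.
have := quad_sup_dist M 0; rewrite quad_sup0 subr0; congr (_ <= _ * _).
by apply: eq_bigr => i _; apply: eq_bigr => j _; rewrite mxE subr0.
Qed.

(** The supremum over [P] may fail to be attained; the lower barrier works with a law that is
    optimal up to [e]. *)
Lemma quad_sup_approx M (e : R) : 0 < e ->
  exists2 rho, P rho & quad_sup M - e < expect rho (quad M).
Proof.
move=> e0; have [|_ [rho Prho <-] h] := @sup_adherent _ [set expect rho (quad
  M) | rho in P] _ e0.
  split; first by have [rho Prho] := P0; exists (expect rho (quad M)), rho.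
  by exists (quad_sup M) => _ [r Pr <-]; exact: expect_le_quad_sup.
by exists rho.
Qed.

End Value.

(** * Taylor expansion and derivatives along lines *)

Section Calculus.
Variable R : realType.

(** The mean value theorem for [f1] gives [|f1 s - f1 0 - f2 0 * s| <= L]; applied then to [f] minus
    its linear and quadratic terms, it gives the claim. The remainder is the oscillation of [f2],
    which a Hoelder bound controls. *)
Lemma taylor_order2 (f f1 f2 : R -> R) (L : R) :
  (forall s : R, is_derive s 1 f (f1 s)) -> (forall s :
    R, is_derive s 1 f1 (f2 s)) ->
  (forall s, 0 <= s <= 1 -> `|f2 s - f2 0| <= L) ->
  `|f 1 - f 0 - f1 0 - f2 0 / 2| <= L.
Proof.
move=> df df1 f2L.
have L0 : 0 <= L by rewrite (le_trans _ (f2L 0 _))// lexx ler01.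
have cont (g dg : R -> R) : (forall s : R, is_derive s 1 g (dg s)) ->
  continuous g.
  by move=> dg' s; apply: differentiable_continuous; apply/derivable1_diffP;
    case: (dg' s).
have f1L (s : R) : 0 <= s <= 1 -> `|f1 s - f1 0 - f2 0 * s| <= L.
  move=> /andP[s0 s1].
  have [|c] := @MVT_segment R f1 f2 0 s s0.
    by apply: continuous_subspaceT; exact: cont df1.
  rewrite in_itv/= => /andP[c0 cs] ->.
  rewrite subr0 -mulrBl normrM (ger0_norm s0).
  by rewrite -[leRHS]mulr1 ler_pM// f2L// c0 (le_trans cs).
pose g (s : R) : R := f s - f1 0 * s - f2 0 / 2 * s ^+ 2.
have dg (s : R) : is_derive s 1 g (f1 s - f1 0 - f2 0 * s).
  have -> : g = f - (f1 0 \*: id) - ((f2 0 / 2) \*: id ^+ 2) by [].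
  apply: is_derive_eq.
  by rewrite /= !scaler1/= /GRing.scale/= expr1; field.
have [|c] := @MVT_segment R g _ 0 1 ler01 (fun s _ => dg s).
  by apply: continuous_subspaceT; exact: cont dg.
rewrite in_itv/= => c01; rewrite subr0 mulr1 /g => e.
rewrite (_ : _ - _ - _ - _ = f1 c - f1 0 - f2 0 * c) ?f1L//.
by rewrite -e; ring.
Qed.

Lemma is_derive_line (V : normedModType R) (f : V -> R) (y v : V) (s : R) :
  differentiable f (y + s *: v) ->
  is_derive s 1 (fun t => f (y + t *: v)) ('D_v f (y + s *: v)).
Proof.
move=> /(@diff_derivable _ _ _ _ _ v) dfv.
have E : (fun h : R => h^-1 *: (((fun t : R => f (y + t *: v)) \o shift s) (h
  *: 1) - f (y + s *: v))) =
    (fun h : R => h^-1 *: ((f \o shift (y + s *: v)) (h *: v) - f (y + s *: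
      v))).
  apply/funext => h /=; do 3 f_equal.
  by rewrite [h *: 1]mulr1 scalerDl addrCA.
by split; [rewrite /derivable E|rewrite /derive E].
Qed.

Lemma is_derive_time (V : normedModType R) (f : V * R -> R) (x : V) (t : R) :
  differentiable f (x, t) -> derivable (fun s => f (x, s)) t 1.
Proof.
have E (s : R) : (x, s) = (x, 0) + s *: (0, 1) :> V * R.
  rewrite (_ : _ + _ = (x + s *: 0, 0 + s *: 1))//.
  by rewrite scaler0 addr0 add0r [s *: 1]mulr1.
move=> df; rewrite (_ : (fun s => _) = (fun s => f ((x, 0) + s *: (0, 1)))).
  by apply: ex_derive; apply: is_derive_line; rewrite -E.
by apply/funext => s; rewrite -E.
Qed.

Lemma derive_dot (d : nat) (f : 'rV[R]_d -> R) (x v : 'rV[R]_d) :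
  differentiable f x -> 'D_v f x = dot (\row_i pd i f x) v.
Proof.
move=> df; rewrite deriveE// [in LHS](row_sum_delta v) linear_sum/=.
rewrite /dot; apply: eq_bigr => i _.
by rewrite linearZ/= -deriveE// mxE mulrC.
Qed.

End Calculus.

(** * Pointwise bounds extracted from the Hoelder norm *)

Section HolderNorm.
Variables (R : realType) (d : nat).
Implicit Types (f : 'rV[R]_d -> R) (D : set 'rV[R]_d).

Lemma supnorm_ge0 D f x : D x -> (0 <= supnorm D f)%E.
Proof.
move=> Dx; apply: (@le_trans _ _ `|f x|%:E); first by rewrite lee_fin.
by apply: ereal_sup_ubound; exists x.
Qed.

Lemma supnorm_le D f x (B : R) : D x -> (supnorm D f <= B%:E)%E -> `|f x| <= B.
Proof.
by move=> Dx h; rewrite -lee_fin (le_trans _ h)//; apply: ereal_sup_ubound;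
  exists x.
Qed.

Lemma holder_seminorm_ge0 (s : R) D f x y : D x -> D y -> x != y ->
  (0 <= holder_seminorm s D f)%E.
Proof.
move=> Dx Dy xy; apply: (@le_trans _ _ (`|f x - f y| / enorm (x - y) `^ s)%:E).
  by rewrite lee_fin divr_ge0 ?powR_ge0.
by apply: ereal_sup_ubound; exists (x, y).
Qed.

Lemma enorm_gt0 (x : 'rV[R]_d) : x != 0 -> 0 < enorm x.
Proof.
move=> x0; rewrite lt_neqAle enorm_ge0 andbT eq_sym;
  apply: contra x0 => /eqP x0.
apply/eqP/rowP => i; rewrite mxE; apply/eqP; rewrite -normr_le0.
by rewrite -x0 coord_le_enorm.
Qed.

Lemma holder_seminorm_le (s : R) D f x y (B : R) :
  D x -> D y -> 0 <= B -> 0 < s ->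
  (holder_seminorm s D f <= B%:E)%E -> `|f x - f y| <= B * enorm (x - y) `^ s.
Proof.
move=> Dx Dy B0 s0 h; have [->|xy] := eqVneq x y.
  by rewrite subrr normr0 mulr_ge0 ?powR_ge0.
rewrite -ler_pdivrMr; last by rewrite powR_gt0// enorm_gt0// subr_eq0.
rewrite -lee_fin (le_trans _ h)//.
by apply: ereal_sup_ubound; exists (x, y).
Qed.

Lemma sume_term_le (I : finType) (F : I -> \bar R) i :
  (forall j, 0 <= F j)%E -> (F i <= \sum_j F j)%E.
Proof.
by move=> F0; rewrite (bigD1 i)//= leeDl// sume_ge0.
Qed.

(** Each summand is at most the norm once all summands are nonnegative. For the Hoelder seminorm
    this takes two distinct points in the ball, since a supremum over no pairs is [-oo]; [0 < d]
    provides [x] and [x + v] with [|v| = 1/2]. *)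
Lemma C2s_norm_bounds (s : R) f x (B : R) : (0 < d)%N -> 0 < s -> 0 <= B ->
  (C2s_norm s (eball x 1) f <= B%:E)%E ->
  [/\ `|f x| <= B, (forall i j, `|pd j (pd i f) x| <= B) &
     forall i j z, enorm (z - x) < 1 ->
      `|pd j (pd i f) z - pd j (pd i f) x| <= B * enorm (z - x) `^ s].
Proof.
move=> d0 s0 B0.
have e0 : enorm (0 : 'rV[R]_d) = 0.
  by rewrite /enorm big1 ?sqrtr0// => i _; rewrite mxE expr0n.
have Dx : eball x 1 x by rewrite /eball/= subrr e0.
pose v : 'rV[R]_d := 2^-1 *: delta_mx ord0 (Ordinal d0).
have ev : enorm v = 2^-1.
  rewrite /v enormZ gtr0_norm ?invr_gt0// /enorm (bigD1 (Ordinal d0))//= big1.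
    by rewrite mxE !eqxx addr0 expr1n sqrtr1 mulr1.
  by move=> i iN; rewrite mxE (negbTE iN) andbF expr0n.
have Dv : eball x 1 (x + v).
  by rewrite /eball/= addrC addKr ev invf_lt1// ltr1n.
have xv : x != x + v.
  rewrite -subr_eq0 opprD addrA subrr add0r oppr_eq0; apply/eqP => v0.
  by move: ev; rewrite v0 e0 => /esym/eqP; rewrite invr_eq0 pnatr_eq0.
have s1 := supnorm_ge0 _ Dx.
have h1 g := holder_seminorm_ge0 s g Dx Dv xv.
rewrite /C2s_norm => h.
have S2 (F : 'I_d -> 'I_d -> \bar R) : (forall i j, 0 <= F i j)%E ->
    (0 <= \sum_(i < d) \sum_(j < d) F i j)%E.
  by move=> F0; apply: sume_ge0 => i _; apply: sume_ge0 => j _.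
have S2l (F : 'I_d -> 'I_d -> \bar R) i j : (forall i j, 0 <= F i j)%E ->
    (F i j <= \sum_(i < d) \sum_(j < d) F i j)%E.
  move=> F0; apply: le_trans (sume_term_le i _).
    exact: sume_term_le.
  by move=> k; apply: sume_ge0 => l _.
have S1 : (0 <= \sum_(i < d) supnorm (eball x 1) (pd i f))%E.
  by apply: sume_ge0.
split=> [|i j|i j z zx].
- apply: (supnorm_le Dx); apply: le_trans h.
  by rewrite -!addeA leeDl// !adde_ge0// S2.
- apply: (supnorm_le Dx); apply: le_trans h.
  apply: le_trans (S2l (fun i j => supnorm (eball x 1) (pd j (pd i f))) i j _)
    _ => //.
  by apply: (le_trans (leeDr _ _)); last apply: leeDl; rewrite ?adde_ge0 ?S2.
- apply: (holder_seminorm_le (D := eball x 1)) => //.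
  apply: le_trans h.
  apply: le_trans (S2l (fun i j => holder_seminorm s (eball x 1) (pd j (pd i
    f))) i j _) _ => //.
  by rewrite leeDr// !adde_ge0// S2.
Qed.

End HolderNorm.

(** * Consistency of the self-similar solution with one step of the recursion *)

Section Profile.
Variables (R : realType) (d : nat) (rad : R) (P : set (Prob R d)).
Variables (Phi : 'rV[R]_d * R -> R) (alpha sigma a K : R).
Hypotheses (d0 : (0 < d)%N) (rad1 : 1 <= rad) (P0 : P !=set0).
Hypothesis PM : P `<=` Mset rad.
Hypotheses (alpha0 : 0 < alpha) (sigma0 : 0 < sigma) (sigma1 : sigma <= 1).
Hypotheses (a0 : 0 < a) (K0 : 0 < K).
Hypothesis PhiC2 : Ck 2 [set z : 'rV[R]_d * R | 0 < z.2] Phi.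
Hypothesis PhiE : solves_pde P Phi.
Hypothesis Phi_scaling : forall (s : R) x (t : R), 0 < s -> 0 < t ->
  Phi (Num.sqrt s *: x, s * t) = s `^ (- alpha) * Phi (x, t).
Hypothesis phiC2 : Ck 2 setT (fun x => Phi (x, 1)).
Hypothesis phi_norm : forall x,
  (C2s_norm sigma (eball x 1%R) (fun y => Phi (y, 1%R))
     <= (K * expR (- a * enorm x ^+ 2))%:E)%E.

Implicit Types (x y z v : 'rV[R]_d) (s t h : R).

Let phi x := Phi (x, 1).
Let B x := K * expR (- a * enorm x ^+ 2).

Let B_gt0 x : 0 < B x.
Proof. by rewrite mulr_gt0 ?expR_gt0. Qed.

Let bounds x : [/\ `|phi x| <= B x, (forall i j, `|hessian phi x i j| <= B x) &
  forall i j z, enorm (z - x) < 1 ->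
    `|hessian phi z i j - hessian phi x i j| <= B x * enorm (z - x) `^ sigma].
Proof.
have [h1 h2 h3] := C2s_norm_bounds d0 sigma0 (ltW (B_gt0 x)) (phi_norm x).
by split=> // [i j|i j z zx]; rewrite !mxE; [exact: h2|exact: h3].
Qed.

Lemma profile_le x : `|phi x| <= B x.
Proof. by have [] := bounds x. Qed.

Let phi_diff x : differentiable phi x.
Proof. by have [+ _] := phiC2; apply. Qed.

Let pd_diff i x : differentiable (pd i phi) x.
Proof. by have [_ /(_ (delta_mx ord0 i)) [+ _]] := phiC2; apply. Qed.

Lemma profile_continuous : continuous phi.
Proof. by move=> x; apply: differentiable_continuous. Qed.

Let sum2_le (F : 'I_d -> 'I_d -> R) (C : R) : (forall i j, F i j <= C) ->
  \sum_i \sum_j F i j <= d%:R ^+ 2 * C.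
Proof.
move=> FC; apply: (@le_trans _ _ (\sum_(i < d) \sum_(j < d) C)).
  by apply: ler_sum => i _; apply: ler_sum.
by rewrite !sumr_const card_ord -mulrnA mulnn -natrX mulr_natl.
Qed.

(** Restrict [phi] to the segment from [y] to [y + v] and apply [taylor_order2]. As [|v| < 1], the
    segment stays in the unit ball around [y], where the Hoelder bound carries the weight [B y]. *)
Lemma profile_taylor y v : enorm v < 1 ->
  `|phi (y + v) - phi y - dot (\row_i pd i phi y) v - quad (hessian phi y) v /
    2|
    <= enorm v ^+ 2 * (d%:R ^+ 2 * (B y * enorm v `^ sigma)).
Proof.
move=> v1.
pose f (s : R) := phi (y + s *: v).
pose f1 (s : R) := \sum_i v ord0 i * pd i phi (y + s *: v).
pose f2 (s : R) := quad (hessian phi (y + s *: v)) v.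
have df s : is_derive s 1 f (f1 s).
  apply: is_derive_eq (is_derive_line (phi_diff _)) _.
  by rewrite derive_dot// /dot /f1; apply: eq_bigr => i _; rewrite mxE mulrC.
have df1 s : is_derive s 1 f1 (f2 s).
  have -> : f1 = \sum_(i < d) (fun s => v ord0 i * pd i phi (y + s *: v)).
    by apply/funext => t; rewrite fct_sumE.
  rewrite /f2 quadE; apply: is_derive_sum => i.
  have -> : (fun s => v ord0 i * pd i phi (y + s *: v)) =
    v ord0 i \*: (fun s => pd i phi (y + s *: v)) by [].
  apply: is_derive_eq (is_deriveZ _ (is_derive_line (pd_diff _ _))) _.
  rewrite derive_dot// /dot scaler_sumr; apply: eq_bigr => j _.
  by rewrite !mxE /GRing.scale/= mulrA.
have := @taylor_order2 R f f1 f2 (enorm v ^+ 2 * (d%:R ^+ 2 * (B y *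
  enorm v `^ sigma))) df df1.
rewrite /f /f1 /f2 scale1r scale0r addr0 => h.
rewrite (_ : dot _ v = \sum_i v ord0 i * pd i phi y); last first.
  by apply: eq_bigr => i _; rewrite mxE mulrC.
apply: h => s /andP[s0 s1].
rewrite (le_trans (quad_dist _ _ (lexx _)))// ler_wpM2l ?sqr_ge0//.
apply: sum2_le => i j; have [_ _ /(_ i j (y + s *: v))] := bounds y.
have e : enorm (y + s *: v - y) <= enorm v.
  by rewrite addrC addKr enormZ ger0_norm// ler_piMl// enorm_ge0.
move=> /(_ (le_lt_trans e v1)) /le_trans; apply.
by rewrite ler_wpM2l ?(ltW (B_gt0 _))// ge0_ler_powR ?nnegrE ?enorm_ge0// ltW.
Qed.

(** By the equation, this is the time derivative of [Phi] at [(y, 1)]. *)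
Let G y := 2^-1 * quad_sup P (hessian phi y).

Lemma Phi_profile x t : 0 < t ->
  Phi (x, t) = t `^ (- alpha) * phi ((Num.sqrt t)^-1 *: x).
Proof.
move=> t0; rewrite -Phi_scaling// mulr1 scalerA divff ?scale1r//.
by rewrite sqrtr_eq0 -ltNge.
Qed.

Let dPhi1 y : derive1 (fun s => Phi (y, s)) 1 = G y.
Proof. by have /eqP := PhiE y ltr01; rewrite /Fop subr_eq0 => /eqP. Qed.

(** Scaling carries the equation from time 1 to time [t]: for [s > 0],
    [Phi (y, s) = t^-alpha Phi (z, s / t)] with [z = y / sqrt t]. *)
Let Phi_is_derive y t : 0 < t ->
  is_derive t 1 (fun s => Phi (y, s)) (t `^ (- alpha) *
    (G ((Num.sqrt t)^-1 *: y) / t)).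
Proof.
move=> t0; set z := _ *: y.
have st : Num.sqrt t != 0 by rewrite sqrtr_eq0 -ltNge.
apply: (@near_eq_is_derive _ _ _ (t `^ (- alpha) \*: ((fun s => Phi (z,
  s)) \o (t^-1 \*: id)))).
  near=> s; have s0 : 0 < s by near: s; exact: (@cvgr_gt _ _ _ _ id t cvg_id 0
    t0).
  rewrite /= /GRing.scale/= -Phi_scaling//; last by rewrite mulr_gt0 ?invr_gt0.
  by rewrite /z scalerA divff// scale1r mulrA divff ?mul1r// gt_eqF.
apply: is_deriveZ; apply: is_derive1_comp; last first.
  by apply: is_derive_eq (is_deriveZ _ (is_derive_id _ _)) _;
    rewrite [_ *: _]mulr1.
rewrite /= /GRing.scale/= mulVf ?gt_eqF//; apply: DeriveDef.
  by apply: is_derive_time; have [+ _] := PhiC2; apply; rewrite /= ltr01.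
by rewrite -derive1E dPhi1.
Unshelve. all: by end_near. Qed.

Let C2 : R := 2^-1 * rad ^+ 2 * d%:R ^+ 2 * K.

Let C2_ge0 : 0 <= C2.
Proof. by rewrite !mulr_ge0 ?invr_ge0 ?ler0n ?(ltW K0)// (le_trans ler01). Qed.

Let twoC2 : 0 <= 2 * C2.
Proof. by rewrite mulr_ge0. Qed.

Let G_le y : `|G y| <= C2 * expR (- a * enorm y ^+ 2).
Proof.
have h : \sum_i \sum_j `|hessian phi y i j| <= d%:R ^+ 2 * B y.
  by apply: sum2_le => i j; have [_ + _] := bounds y; apply.
rewrite /G normrM ger0_norm ?invr_ge0//.
rewrite (_ : C2 * _ = 2^-1 * (rad ^+ 2 * (d%:R ^+ 2 * B y)));
  last by rewrite /C2 /B; ring.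
rewrite ler_wpM2l ?invr_ge0// (le_trans (quad_sup_norm_le P0 PM _))//.
by rewrite ler_wpM2l ?sqr_ge0.
Qed.

Let G_holder y z : enorm (z - y) < 1 ->
  `|G z - G y| <= C2 * expR (- a * enorm y ^+ 2) * enorm (z - y) `^ sigma.
Proof.
move=> zy.
have h : \sum_i \sum_j `|hessian phi z i j - hessian phi y i j|
    <= d%:R ^+ 2 * (B y * enorm (z - y) `^ sigma).
  by apply: sum2_le => i j; have [_ _] := bounds y; apply.
rewrite /G -mulrBr normrM ger0_norm ?invr_ge0//.
rewrite (_ : C2 * _ * _ = 2^-1 * (rad ^+ 2 * (d%:R ^+ 2 * (B y *
  enorm (z - y) `^ sigma)))); last by rewrite /C2 /B; ring.
rewrite ler_wpM2l ?invr_ge0// (le_trans (quad_sup_dist P0 PM _ _))//.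
by rewrite ler_wpM2l ?sqr_ge0.
Qed.

(** Parabolic scaling: a spatial increment of order [n^(-1/2)] contributes [n^(- sigma / 2)] through
    the Hoelder seminorm. *)
Let theta : R := sigma / 2.

Let theta_sigma : theta <= sigma.
Proof. by rewrite ler_pdivrMr// ler_peMr ?ler1n// ltW. Qed.

Let theta_le1 : theta <= 1.
Proof. exact: le_trans theta_sigma sigma1. Qed.

(* For [|y| h < 1] this is the Hoelder bound, for [|y| h >= 1] the decay of [G];
   both leave a factor [|y|^sigma <= 1 + |y|^2 <= (1 + 4 / a) exp (a |y|^2 / 4)]. *)
Let G_rescale y s h : 0 < h <= 1 -> 1 <= s <= 1 + h ->
  `|G ((Num.sqrt s)^-1 *: y) - G y| <=
  2 * C2 * h `^ sigma * ((1 + 4 / a) * expR (- (a / 4 * enorm y ^+ 2))).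
Proof.
move=> /andP[h0 h1] /andP[s1 sh].
set z := _ *: y; set q := enorm y; have q0 : 0 <= q by exact: enorm_ge0.
have s0 : 0 < s by lra.
have r1 : 1 <= Num.sqrt s by rewrite -sqrtr1 ler_wsqrtr.
have rs : Num.sqrt s ^+ 2 = s by rewrite sqr_sqrtr// ltW.
have r0 : 0 < Num.sqrt s by rewrite (lt_le_trans ltr01).
have rV1 : (Num.sqrt s)^-1 <= 1 by rewrite invf_le1.
have rV0 : 0 < (Num.sqrt s)^-1 by rewrite invr_gt0.
have zy : enorm (z - y) <= q * h.
  rewrite /z -[X in _ - X]scale1r -scalerBl enormZ mulrC ler_wpM2l//.
  rewrite distrC ger0_norm ?subr_ge0//.
  rewrite -(@ler_pM2r _ (Num.sqrt s))// mulrBl mulVf ?gt_eqF// mul1r.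
  nra.
(* Here [s <= 2], so rescaling at most halves [|y|^2], and the decay of [G z] is measured at [y]
   with half the rate. *)
have zq : enorm z ^+ 2 >= q ^+ 2 / 2.
  rewrite /z enormZ (gtr0_norm rV0) exprMn exprVn rs -/q [leRHS]mulrC ler_wpM2l
    ?sqr_ge0//.
  by rewrite lef_pV2 ?posrE//; lra.
have qh : (q * h) `^ sigma = q `^ sigma * h `^ sigma by rewrite powRM// ltW.
have main :
    `|G z - G y| <= 2 * C2 * expR (- (a / 2 * q ^+ 2)) * (q * h) `^ sigma.
  have e2 : expR (- a * q ^+ 2) <= expR (- (a / 2 * q ^+ 2)).
    by rewrite ler_expR; have := mulr_ge0 (ltW a0) (sqr_ge0 q); lra.
  have [zy1|zy1] := ltP (q * h) 1.
    rewrite (le_trans (G_holder (le_lt_trans zy zy1)))//.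
    apply: ler_pM; rewrite ?powR_ge0//.
    - by rewrite mulr_ge0 ?expR_ge0.
    - by rewrite ler_pM ?expR_ge0// mulr_natl mulr2n lerDl.
    - by rewrite ge0_ler_powR ?nnegrE ?enorm_ge0// ?mulr_ge0// ltW.
  have p1 : 1 <= (q * h) `^ sigma.
    by rewrite -(powRr0 (q * h)) ler_powR// ltW.
  rewrite (le_trans (ler_normB _ _))//.
  apply: (@le_trans _ _ (2 * C2 * expR (- (a / 2 * q ^+ 2)))); last first.
    by rewrite ler_peMr// mulr_ge0 ?twoC2// expR_ge0.
  rewrite -mulrA mulr_natl mulr2n lerD// (le_trans (G_le _))// ler_wpM2l//.
  by rewrite ler_expR; have := ler_wpM2l (ltW a0) zq; lra.
rewrite (le_trans main)// qh; set e := expR (- (a / 2 * _)).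
have -> : 2 * C2 * e * (q `^ sigma * h `^ sigma) =
  2 * C2 * h `^ sigma * (q `^ sigma * e).
  by move: (2 * C2) (q `^ _) (h `^ _) e => u1 u2 u3 u4; ring.
apply: ler_wpM2l; first by rewrite mulr_ge0 ?twoC2// powR_ge0.
rewrite {}/e.
have qs : q `^ sigma <= 1 + q ^+ 2.
  have [q1|q1] := leP q 1.
    apply: (@le_trans _ _ 1); last by rewrite lerDl sqr_ge0.
    have <- : 1 `^ sigma = 1 by rewrite powR1.
    by rewrite ge0_ler_powR ?nnegrE// ltW.
  apply: (le_trans (ler1_powR (ltW q1) sigma1)); nra.
have ex := expR_ge1Dx (a / 4 * q ^+ 2).
have q2 : 1 + q ^+ 2 <= (1 + 4 / a) * expR (a / 4 * q ^+ 2).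
  apply: (@le_trans _ _ ((1 + 4 / a) * (1 + a / 4 * q ^+ 2))).
    rewrite mulrDr mulr1 [(1 + _) * _]mulrDl mul1r.
    rewrite (_ : 4 / a * _ = q ^+ 2); last by field; rewrite gt_eqF.
    have : 0 <= 4 / a by rewrite divr_ge0// ltW.
    have : 0 <= a / 4 * q ^+ 2 by rewrite mulr_ge0 ?sqr_ge0// divr_ge0// ltW.
    lra.
  by rewrite ler_wpM2l// addr_ge0// divr_ge0// ltW.
rewrite [leRHS](_ : _ = (1 + 4 / a) * expR (a / 4 * q ^+ 2) *
  expR (- (a / 2 * q ^+ 2))); last first.
  by rewrite -[RHS]mulrA -expRD; congr (_ * expR _); field.
by rewrite ler_wpM2r ?expR_ge0// (le_trans qs).
Qed.

(** By the mean value theorem the increment is [h k G z], where [k = c^(- alpha - 1)] and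
    [z = y / sqrt c] for some [c] between 1 and [1 + h]. The error is
    [h (k (G z - G y) - (1 - k) G y)]; [G_rescale] bounds the first difference and
    [1 - k <= (alpha + 1) h] handles the second. *)
Let time_step : exists2 C : R, 0 < C & forall y h, 0 < h <= 1 ->
  `|Phi (y, 1 + h) - phi y - h * G y| <=
    C * (h * h `^ theta) * expR (- (a / 4 * enorm y ^+ 2)).
Proof.
pose C := 2 * C2 * (1 + 4 / a) + (alpha + 1) * C2 + 1.
have a4 : 0 <= 4 / a by rewrite divr_ge0// ltW.
have h4 : 0 <= 2 * C2 * (1 + 4 / a) by rewrite mulr_ge0 ?twoC2// addr_ge0.
have hal : 0 <= (alpha + 1) * C2 by rewrite mulr_ge0// addr_ge0// ltW.
exists C; first by rewrite /C; lra.
move=> y h /andP[h0 h1]; set q := enorm y; set e := expR _.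
have [|||c] := @MVT_segment R (fun s => Phi (y, s))
  (fun t => t `^ (- alpha) * (G ((Num.sqrt t)^-1 *: y) / t)) 1 (1 + h).
- by rewrite lerDl ltW.
- move=> t; rewrite in_itv/= => /andP[t1 _].
  by apply: Phi_is_derive; rewrite (lt_trans ltr01).
- apply: derivable_within_continuous => t; rewrite in_itv/= => /andP[t1 _].
  by have [] := @Phi_is_derive y t (lt_le_trans ltr01 t1).
rewrite in_itv/= => /andP[c1 ch]; rewrite -/(phi y) => ->.
have c0 : 0 < c by rewrite (lt_le_trans ltr01).
rewrite (addrC 1) addrK; set z := _ *: y.
set k := c `^ (- alpha) / c.
have kE : k = expR (- ((alpha + 1) * ln c)).
  rewrite /k /powR gt_eqF// -{2}(lnK c0) -expRN -expRD; congr expR; ring.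
have lnc0 : 0 <= ln c by rewrite ln_ge0.
have k1 : k <= 1.
  by rewrite kE -[leRHS]expR0 ler_expR oppr_le0 mulr_ge0// addr_ge0// ltW.
have lnch : ln c <= h.
  have := @le_ln1Dx R (c - 1); rewrite (addrC 1) subrK => /(_ _)/le_trans;
    apply; lra.
have kh : 1 - k <= (alpha + 1) * h.
  have := expR_ge1Dx (- ((alpha + 1) * ln c)); rewrite -kE => k2.
  have : (alpha + 1) * ln c <= (alpha + 1) * h by rewrite ler_wpM2l//
    addr_ge0// ltW.
  lra.
have k0 : 0 <= k by rewrite kE expR_ge0.
have hG : `|G z - G y| <= 2 * C2 * h `^ theta * ((1 + 4 / a) * e).
  apply: le_trans (@G_rescale y c h _ _) _; rewrite ?h0 ?c1//.
  rewrite ler_wpM2r ?mulr_ge0 ?expR_ge0 ?addr_ge0// ler_wpM2l ?twoC2//.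
  by rewrite ger_powR ?h0.
have hy : `|G y| <= C2 * e.
  rewrite (le_trans (G_le _))// ler_wpM2l// ler_expR -/q.
  by have := mulr_ge0 (ltW a0) (sqr_ge0 q); lra.
have hh : h <= h `^ theta by rewrite ger1_powR ?h0.
rewrite (_ : c `^ (- alpha) * (G z / c) = k * G z);
  last by rewrite /k mulrA mulrAC.
have e0 : 0 <= e by exact: expR_ge0.
have t0 : 0 <= h `^ theta by exact: powR_ge0.
move: k e (G z) (G y) (h `^ theta) k0 k1 kh hG hy hh e0 t0 {kE} => k e gz gy ht
  k0 k1 kh hG hy hh e0 t0.
rewrite (_ : k * gz * h - _ = h * (k * (gz - gy) - (1 - k) * gy)); last by ring.
rewrite normrM (gtr0_norm h0) -mulrA -mulrA mulrCA ler_wpM2l ?(ltW h0)//.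
rewrite (le_trans (ler_normB _ _))// !normrM (ger0_norm k0).
rewrite (@ger0_norm _ (1 - k)) ?subr_ge0//.
have t1 : k * `|gz - gy| <= 2 * C2 * ht * ((1 + 4 / a) * e).
  by rewrite (le_trans _ hG)// ler_piMl.
have t2 : (1 - k) * `|gy| <= (alpha + 1) * ht * (C2 * e).
  rewrite ler_pM// ?subr_ge0// (le_trans kh)// ler_wpM2l// addr_ge0// ltW//.
rewrite (le_trans (lerD t1 t2))// /C.
move: (C2) (4 / a) => c2 a4'.
rewrite [leLHS](_ : _ = (2 * c2 * (1 + a4') + (alpha + 1) * c2) * (ht * e));
  last by ring.
by rewrite ler_wpM2r ?mulr_ge0// lerDl.
Qed.

Let C1 : R := rad ^+ 2 * rad `^ sigma * d%:R ^+ 2 * K.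

(** Average [profile_taylor] with [v = e x] over the support: the gradient term vanishes because
    [rho] is centered, and [e^sigma = (e^2)^theta]. *)
Let space_step y (e : R) rho : P rho -> 0 < e -> e * rad < 1 ->
  `|expect rho (fun x => phi (y + e *: x)) - phi y
    - e ^+ 2 / 2 * expect rho (quad (hessian phi y))|
  <= C1 * (e ^+ 2 * (e ^+ 2) `^ theta) * expR (- a * enorm y ^+ 2).
Proof.
move=> /PM rhoP e0 er; have [_ rhoM] := rhoP.
have rad0 : 0 <= rad by rewrite (le_trans ler01).
set g := \row_i pd i phi y; set M := hessian phi y.
set L := _ * expR _.
have eth : (e ^+ 2) `^ theta = e `^ sigma.
  by rewrite -(powR_mulrn _ (ltW e0)) -powRrM /theta mulrC divfK.
have pt x : enorm x <= rad ->
    `|phi (y + e *: x) - phi y - e * dot g x - e ^+ 2 / 2 * quad M x| <= L.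
  move=> xr.
  have ex : enorm (e *: x) <= e * rad.
    by rewrite enormZ gtr0_norm// ler_pM2l.
  have := profile_taylor y (le_lt_trans ex er).
  have -> : dot g (e *: x) = e * dot g x.
    by rewrite /dot mulr_sumr; apply: eq_bigr => i _;
      rewrite [(e *: x) _ _]mxE mulrCA.
  have -> : quad M (e *: x) = e ^+ 2 * quad M x.
    rewrite !quadE mulr_sumr; apply: eq_bigr => i _.
    rewrite mulr_sumr; apply: eq_bigr => j _; rewrite ![(e *: x) _ _]mxE.
    by move: (M i j) => m; ring.
  rewrite mulrAC => /le_trans; apply.
  apply: (@le_trans _ _ ((e * rad) ^+ 2 * (d%:R ^+ 2 * (B y * (e *
    rad) `^ sigma)))).
    rewrite ler_pM ?sqr_ge0//.
    - by rewrite mulr_ge0 ?sqr_ge0// mulr_ge0 ?powR_ge0// ltW.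
    - by rewrite ler_pXn2r ?nnegrE ?enorm_ge0// mulr_ge0// ltW.
    rewrite ler_wpM2l ?sqr_ge0// ler_wpM2l ?(ltW (B_gt0 y))//.
    by rewrite ge0_ler_powR ?nnegrE ?enorm_ge0// ?mulr_ge0// ltW.
  rewrite powRM ?(ltW e0)// /L /C1 /B eth le_eqVlt; apply/orP; left; apply/eqP.
  by move: (expR _) (e `^ _) (rad `^ _) => u1 u2 u3; ring.
have cphi : continuous (fun x => phi (y + e *: x)).
  move=> x; apply: (@continuous_comp _ _ _ (fun x => y + e *: x)).
    exact: (cvgD (cvg_cst _) (cvgZ (cvg_cst _) cvg_id)).
  exact: profile_continuous.
have cd : continuous (fun x => e * dot g x).
  by move=> x; exact: (cvgM (cvg_cst _) (@dot_continuous R d g x)).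
have cq : continuous (fun x => e ^+ 2 / 2 * quad M x).
  by move=> x; exact: (cvgM (cvg_cst _) (@quad_continuous R d M x)).
have cdq : continuous (fun x => e * dot g x + e ^+ 2 / 2 * quad M x).
  by move=> x; exact: (cvgD (cd x) (cq x)).
(* The Taylor bound is used as two one-sided comparisons with quadratic polynomials whose
   expectation is explicit, with constant terms [phi y + L] and [phi y - L]. *)
have poly c : continuous (fun x => c + (e * dot g x + e ^+ 2 / 2 * quad M x)) /\
    expect rho (fun x => c + (e * dot g x + e ^+ 2 / 2 * quad M x)) =
    c + e ^+ 2 / 2 * expect rho (quad M).
  split; first by move=> x; exact: (cvgD (cvg_cst _) (cdq x)).
  rewrite (expect_add rhoM)//; last exact: cst_continuous.
  rewrite expect_cst (expect_add rhoM)// !(expect_scale rhoM).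
  - by rewrite (expect_dot _ rhoP) mulr0 add0r.
  - exact: quad_continuous.
  - exact: dot_continuous.
have [c1 p1] := poly (phi y + L); have [c2 p2] := poly (phi y - L).
have up : expect rho (fun x => phi (y + e *: x)) <=
  phi y + L + e ^+ 2 / 2 * expect rho (quad M).
  rewrite -p1; apply: (le_expect rhoM) => // x /pt;
    rewrite ler_norml => /andP[_].
  by move: (phi _) (phi _) (dot _ _) (quad _ _) (L) => u1 u2 u3 u4 u5; lra.
have lo : phi y - L + e ^+ 2 / 2 * expect rho (quad M) <=
  expect rho (fun x => phi (y + e *: x)).
  rewrite -p2; apply: (le_expect rhoM) => // x /pt;
    rewrite ler_norml => /andP[+ _].
  by move: (phi _) (phi _) (dot _ _) (quad _ _) (L) => u1 u2 u3 u4 u5; lra.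
rewrite ler_norml; apply/andP; split; move: up lo;
  by move: (expect _ _) (expect _ _) (phi _) (L) => u1 u2 u3 u4; lra.
Qed.

(** With time increment [e^2], the expansions in space and in time have the same main term [e^2 / 2]
    times [quad_sup], up to the choice of the law: any law gives at most this, a nearly optimal one
    nearly attains it. *)
Let unit_step : exists2 C : R, 0 < C & forall y (e :
  R), 0 < e <= 1 -> e * rad < 1 ->
  (forall rho, P rho -> expect rho (fun x => phi (y + e *: x)) <= Phi (y,
    1 + e ^+ 2)
      + C * ((e ^+ 2 * (e ^+ 2) `^ theta) * expR (- (a / 4 * enorm y ^+ 2)))) /\
  (exists2 rho, P rho & Phi (y, 1 + e ^+ 2)
      - C * ((e ^+ 2 * (e ^+ 2) `^ theta) * expR (- (a / 4 * enorm y ^+ 2)))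
      <= expect rho (fun x => phi (y + e *: x))).
Proof.
have [C C0 Ct] := time_step.
have C1_ge0 : 0 <= C1 by rewrite !mulr_ge0 ?powR_ge0 ?sqr_ge0 ?(ltW K0)//
  (le_trans ler01).
exists (C + C1 + 1) => [|y e /andP[e0 e1] er].
  by rewrite ltr_pwDr// addr_ge0// ltW.
have h01 : 0 < e ^+ 2 <= 1 by rewrite exprn_gt0//= exprn_ile1// ltW.
have := Ct y _ h01.
have q0 := sqr_ge0 (enorm y).
set q := enorm y ^+ 2 in q0 *; set E := expR (- (a / 4 * q)).
set hh := e ^+ 2 * _ `^ _ => ct.
have E0 : 0 < E by exact: expR_gt0.
have th0 : 0 < (e ^+ 2) `^ theta by rewrite powR_gt0// exprn_gt0.
have hh0 : 0 < hh by rewrite mulr_gt0// exprn_gt0.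
have EE : expR (- a * q) <= E.
  by rewrite ler_expR; have := mulr_ge0 (ltW a0) q0; lra.
have sp rho : P rho ->
  `|expect rho (fun x => phi (y + e *: x)) - phi y
    - e ^+ 2 / 2 * expect rho (quad (hessian phi y))| <= C1 * hh * E.
  move=> Pr; apply: (le_trans (space_step y Pr e0 er)).
  by rewrite ler_wpM2l// mulr_ge0// ltW.
split=> [rho Pr|].
  have := sp _ Pr; have := expect_le_quad_sup PM (hessian phi y) Pr.
  move: ct; rewrite /G !ler_norml => /andP[+ _] + /andP[_ +].
  move: (expect _ _) (expect _ _) (phi y) (Phi _) (quad_sup _ _) => u1 u2 u3 u4
    u5 g1 g2 g3.
  have : e ^+ 2 / 2 * u2 <= e ^+ 2 / 2 * u5.
    by rewrite ler_wpM2l// divr_ge0// sqr_ge0.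
  have : 0 <= hh * E by rewrite mulr_ge0 ?(ltW hh0) ?(ltW E0).
  by nra.
(* This tolerance, weighted by [e^2 / 2], costs half the admissible error, covered by the [+ 1] in
   the constant. *)
have [|rho Pr qr] := @quad_sup_approx R d rad P P0 PM (hessian phi y) ((e ^+ 2)
  `^ theta * E).
  by rewrite mulr_gt0.
exists rho => //; have := sp _ Pr.
move: ct qr; rewrite /G !ler_norml => /andP[_ +] + /andP[+ _].
move: (expect _ _) (expect _ _) (phi y) (Phi _) (quad_sup _ _) => u1 u2 u3 u4
  u5 g1 g2 g3.
have : e ^+ 2 / 2 * (u5 - (e ^+ 2) `^ theta * E) <= e ^+ 2 / 2 * u2.
  by rewrite ler_wpM2l ?(ltW g2)// divr_ge0// sqr_ge0.
have -> : e ^+ 2 / 2 * (u5 - (e ^+ 2) `^ theta * E) =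
  e ^+ 2 * (2^-1 * u5) - hh * E / 2.
  by rewrite /hh; move: ((e ^+ 2) `^ theta) => u6; field.
have : 0 <= hh * E by rewrite mulr_ge0 ?(ltW hh0) ?(ltW E0).
by nra.
Qed.

(** Rescaling of [unit_step] with [e = 1 / sqrt s]; the condition [rad ^+ 2 < s] keeps the jumps
    [e * rad] below 1. The prefactor [s^-alpha] times [e^2 (e^2)^theta] yields the power of [s] in
    [err]. *)
Lemma Phi_step : exists2 C : R, 0 < C & forall s x, 1 <= s -> rad ^+ 2 < s ->
  let err := C * (s `^ (- (alpha + theta + 1)) * gauss (a / 4) s x) in
  (forall rho, P rho ->
     expect rho (fun y => Phi (x + y, s)) <= Phi (x, s + 1) + err) /\
  (exists2 rho, P rho &
     Phi (x, s + 1) - err <= expect rho (fun y => Phi (x + y, s))).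
Proof.
have [C C0 st] := unit_step; exists C => // s x s1 rs err.
have s0 : 0 < s by rewrite (lt_le_trans ltr01).
have r1 : 1 <= Num.sqrt s by rewrite -sqrtr1 ler_wsqrtr.
have sq : Num.sqrt s ^+ 2 = s by rewrite sqr_sqrtr// ltW.
have r0 : 0 < Num.sqrt s by rewrite (lt_le_trans ltr01).
pose e := (Num.sqrt s)^-1; pose y := e *: x.
have e0 : 0 < e by rewrite invr_gt0.
have e2 : e ^+ 2 = s^-1 by rewrite exprVn sq.
have pa : 0 < s `^ (- alpha) by rewrite powR_gt0.
have er : e * rad < 1.
  rewrite mulrC ltr_pdivrMr// mul1r -(@ltr_pXn2r _ 2) ?nnegrE ?sq ?(ltW r0)//.
  by rewrite (le_trans ler01).
have e1 : 0 < e <= 1 by rewrite e0 invf_le1.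
have [h1 h2] := st y e e1 er.
have PE z : Phi (x + z, s) = s `^ (- alpha) * phi (y + e *: z).
  by rewrite Phi_profile// scalerDr.
have P1 : Phi (x, s + 1) = s `^ (- alpha) * Phi (y, 1 + e ^+ 2).
  rewrite -Phi_scaling ?addr_gt0 ?exprn_gt0// /y scalerA divff ?gt_eqF//
    scale1r.
  by rewrite e2 mulrDr mulr1 divff ?gt_eqF.
have errE : err = s `^ (- alpha) * (C * ((e ^+ 2 * (e ^+ 2) `^ theta) *
    expR (- (a / 4 * enorm y ^+ 2)))).
  rewrite /err /gauss /y enormZ (gtr0_norm e0) exprMn e2.
  have -> : s `^ (- (alpha + theta + 1)) = s `^ (- alpha) * (s^-1 *
    s^-1 `^ theta).
    rewrite /powR !gt_eqF ?invr_gt0// lnV ?posrE//.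
    rewrite -{3}(lnK s0) -expRN -!expRD; congr expR; ring.
  rewrite (_ : a / 4 * (s^-1 * _) = a / 4 * enorm x ^+ 2 / s); last by ring.
  by move: (expR _) (_ `^ _) (_ `^ _) => u1 u2 u3; ring.
have cphi : continuous (fun z => phi (y + e *: z)).
  move=> z; apply: (@continuous_comp _ _ _ (fun z => y + e *: z)).
    exact: (cvgD (cvg_cst _) (cvgZ (cvg_cst _) cvg_id)).
  exact: profile_continuous.
have EE rho : P rho -> expect rho (fun z => Phi (x + z, s)) =
    s `^ (- alpha) * expect rho (fun z => phi (y + e *: z)).
  move=> /PM[_ rhoM]; rewrite -(expect_scale rhoM)//; congr expect.
  by apply/funext => z; rewrite PE.
rewrite P1 errE; split=> [rho Pr|].
  by rewrite EE// -mulrDr ler_pM2l// h1.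
by have [rho Pr hr] := h2; exists rho => //; rewrite EE// -mulrBr ler_pM2l.
Qed.

End Profile.

(** * Discrete decay of negative powers, and limits superior and inferior *)

Section Powers.
Variable R : realType.
Implicit Types s t u c : R.

Lemma expRN_le u : 0 <= u <= 1 -> expR (- u) <= 1 - u / 2.
Proof.
move=> /andP[u0 u1]; have e := expR_ge1Dx u.
rewrite expRN invf_ple ?posrE ?expR_gt0//; last lra.
rewrite (le_trans _ e)// -[leLHS]mul1r ler_pdivrMr; last lra.
nra.
Qed.

Lemma powR_succ s c : 0 < s -> (s + 1) `^ c = s `^ c * expR (c * ln (1 + s^-1)).
Proof.
move=> s0; have s1 : 0 < 1 + s^-1 by rewrite addr_gt0// invr_gt0.
have -> : s + 1 = s * (1 + s^-1) by rewrite mulrDr mulr1 divff ?gt_eqF.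
by rewrite powRM ?ltW// {2}/powR gt_eqF.
Qed.

Lemma ln_succ_bounds s : 1 <= s -> (2 * s)^-1 <= ln (1 + s^-1) <= s^-1.
Proof.
move=> s1; have s0 : 0 < s by rewrite (lt_le_trans ltr01).
have si : 0 < s^-1 by rewrite invr_gt0.
apply/andP; split; last by apply: le_ln1Dx; rewrite (lt_trans _ si)// ltrN10.
(* In this form the lower bound follows from [ln (1 - t) <= - t] at [t = 1 / (s + 1)]. *)
have -> : 1 + s^-1 = (1 - (s + 1)^-1)^-1 by field; rewrite !gt_eqF//; lra.
have si1 : 0 < (s + 1)^-1 by rewrite invr_gt0; lra.
have si2 : (s + 1)^-1 <= 2^-1 by rewrite lef_pV2 ?posrE//; lra.
rewrite lnV ?posrE; last lra.
have h : ln (1 - (s + 1)^-1) <= - (s + 1)^-1 by apply: le_ln1Dx; lra.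
rewrite (@le_trans _ _ (s + 1)^-1)//; last by rewrite lerNr.
by rewrite lef_pV2 ?posrE; lra.
Qed.

Lemma powR_neg1 s c : 0 < s -> s `^ (- (c + 1)) = s `^ (- c) * s^-1.
Proof.
move=> s0; rewrite opprD powRD ?powR_inv1 ?ltW//.
by rewrite (gt_eqF s0) implybT.
Qed.

Lemma powRN_succ_le s c : 1 <= s -> 0 < c ->
  s `^ (- c) - (s + 1) `^ (- c) <= c * s `^ (- (c + 1)).
Proof.
move=> s1 c0; have s0 : 0 < s by rewrite (lt_le_trans ltr01).
rewrite powR_succ// powR_neg1// -[X in X - _]mulr1 -mulrBr mulrCA ler_wpM2l
  ?powR_ge0//.
have /andP[_ h] := ln_succ_bounds s1.
have := expR_ge1Dx (- c * ln (1 + s^-1)).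
have : c * ln (1 + s^-1) <= c * s^-1 by rewrite ler_wpM2l// ltW.
lra.
Qed.

Lemma powRN_succ_ge s c : 1 <= s -> 0 < c <= 1 ->
  c / 4 * s `^ (- (c + 1)) <= s `^ (- c) - (s + 1) `^ (- c).
Proof.
move=> s1 /andP[c0 c1]; have s0 : 0 < s by rewrite (lt_le_trans ltr01).
rewrite powR_succ// powR_neg1// -[X in _ <= X - _]mulr1 -mulrBr mulrCA
  ler_wpM2l ?powR_ge0//.
have /andP[h _] := ln_succ_bounds s1.
have si : 0 < s^-1 by rewrite invr_gt0.
have si1 : s^-1 <= 1 by rewrite invf_le1.
have u01 : 0 <= c * (2 * s)^-1 <= 1.
  rewrite invfM mulr_ge0 ?mulr_ge0 ?(ltW c0) ?(ltW si) ?invr_ge0//=.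
  by nra.
have := expRN_le u01.
have : expR (- c * ln (1 + s^-1)) <= expR (- (c * (2 * s)^-1)).
  by rewrite ler_expR mulNr lerN2 ler_pM2l.
rewrite invfM; lra.
Qed.

Lemma powRN_double s c : 1 <= s -> 0 < c -> 2 `^ (- c) * s `^ (- c) <=
  (s + 1) `^ (- c).
Proof.
move=> s1 c0; have s0 : 0 < s by rewrite (lt_le_trans ltr01).
rewrite -powRM ?(ltW s0)// !powRN lef_pV2 ?posrE ?powR_gt0//; try lra.
by rewrite ge0_ler_powR ?nnegrE ?(ltW c0)//; lra.
Qed.

(** The ratio of [s^-c] to [(s + 1)^-c] is at most [exp (c / s)], so a damping of
    [exp (- (c + 1) / s)] leaves a net factor [exp (- 1 / s) <= 1 - 1 / (2 s)]. This makes the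
    Gaussian a strict supersolution far out. *)
Lemma powRN_succ_decay s c u : 1 <= s -> 0 < c -> (c + 1) / s <= u ->
  s `^ (- c) * expR (- u) - (s + 1) `^ (- c)
    <= - (2 `^ (- c) / 2 * s `^ (- (c + 1))).
Proof.
move=> s1 c0 us; have s0 : 0 < s by rewrite (lt_le_trans ltr01).
have si : 0 < s^-1 by rewrite invr_gt0.
have si1 : s^-1 <= 1 by rewrite invf_le1.
have /andP[_ h] := ln_succ_bounds s1.
set p := (s + 1) `^ (- c).
have p0 : 0 < p by rewrite powR_gt0//; lra.
have sp : s `^ (- c) = p * expR (c * ln (1 + s^-1)).
  by rewrite /p powR_succ// -mulrA -expRD mulNr addNr expR0 mulr1.
have e1 : s `^ (- c) * expR (- u) <= p * (1 - s^-1 / 2).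
  rewrite sp -mulrA -expRD ler_pM2l//.
  apply: le_trans (expRN_le _); last by rewrite (ltW si).
  rewrite ler_expR.
  have : c * ln (1 + s^-1) <= c * s^-1 by rewrite ler_wpM2l// ltW.
  by move: us; rewrite mulrDl mul1r; lra.
have e2 : 2 `^ (- c) * s `^ (- c) * (s^-1 / 2) <= p * (s^-1 / 2).
  by rewrite ler_wpM2r ?powRN_double// divr_ge0// ltW.
rewrite powR_neg1//.
move: e1 e2; move: (s `^ (- c)) (2 `^ (- c)) (expR _) p {p0 sp} => v1 v2 v3 v4.
by move=> e1 e2; lra.
Qed.

Lemma powRN_le_eps c (e : R) : 0 < c -> 0 < e ->
  exists n0 : nat, forall n : nat, (n0 <= n)%N -> n%:R `^ (- c) <= e.
Proof.
move=> c0 e0; pose X := e^-1 `^ c^-1.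
have X0 : 0 < X by rewrite powR_gt0// invr_gt0.
exists (Num.bound X) => n Xn.
have Xn' : X <= n%:R.
  by rewrite (le_trans (ltW (archi_boundP (ltW X0))))// ler_nat.
rewrite powRN invf_ple ?posrE ?powR_gt0//; last by rewrite (lt_le_trans X0).
rewrite (_ : e^-1 = X `^ c); last first.
  by rewrite /X -powRrM mulVf ?gt_eqF// powRr1// invr_ge0 ltW.
by rewrite ge0_ler_powR ?nnegrE ?(ltW c0) ?(ltW X0).
Qed.

Lemma limn_esup_le (u : (\bar R)^nat) (N : nat) (c : \bar R) :
  (forall n, (N <= n)%N -> u n <= c)%E -> (limn_esup u <= c)%E.
Proof.
move=> uc; rewrite limn_esup_lim (cvg_lim _ (@cvg_esups_inf _ u))//.
apply: (@le_trans _ _ (esups u N)); first by apply: ereal_inf_lbound; exists N.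
by apply: ge_ereal_sup => _ [n /= Nn <-]; exact: uc.
Qed.

Lemma limn_einf_ge (u : (\bar R)^nat) (N : nat) (c : \bar R) :
  (forall n, (N <= n)%N -> c <= u n)%E -> (c <= limn_einf u)%E.
Proof.
move=> uc; rewrite limn_einf_lim (cvg_lim _ (@cvg_einfs_sup _ u))//.
apply: (@le_trans _ _ (einfs u N)); last by apply: ereal_sup_ubound; exists N.
by apply: le_ereal_inf_tmp => _ [n /= Nn <-]; exact: uc.
Qed.

End Powers.

(** * Order properties of the Gaussian *)

Section Gauss.
Variables (R : realType) (d : nat).
Implicit Types (b s : R) (x : 'rV[R]_d).

Lemma gauss_gt0 b s x : 0 < gauss b s x.
Proof. exact: expR_gt0. Qed.

Lemma gauss_le1 b s x : 0 <= b -> 0 <= s -> gauss b s x <= 1.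
Proof.
move=> b0 s0; rewrite /gauss -[leRHS]expR0 ler_expR oppr_le0.
by rewrite divr_ge0// mulr_ge0// sqr_ge0.
Qed.

Lemma gauss_le b s b' s' x : b' / s' <= b / s -> gauss b s x <= gauss b' s' x.
Proof.
move=> h; rewrite ler_expR lerN2 mulrAC (mulrAC b) ler_wpM2r ?sqr_ge0//.
Qed.

End Gauss.

(** * Barriers, comparison and the bounds on the ratio *)

Section Barriers.
Variables (R : realType) (d : nat) (rad delta : R) (P : set (Prob R d)).
Variables (Phi : 'rV[R]_d * R -> R) (alpha theta a K C : R).
Hypotheses (d0 : (0 < d)%N) (rad1 : 1 <= rad) (P0 : P !=set0).
Hypothesis PM : P `<=` Mset rad.
Hypotheses (alpha0 : 0 < alpha) (theta0 : 0 < theta) (theta1 : theta <= 1).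
Hypotheses (a0 : 0 < a) (K0 : 0 < K) (C0 : 0 < C).
Implicit Types (x y z : 'rV[R]_d) (s : R).

Let phi x := Phi (x, 1).
Hypothesis Phi_profile : forall x (t : R), 0 < t ->
  Phi (x, t) = t `^ (- alpha) * phi ((Num.sqrt t)^-1 *: x).
Hypothesis phi_cont : continuous phi.
Hypothesis phi_gt0 : forall x, 0 < phi x.
Hypothesis phi_le : forall x, phi x <= K * expR (- a * enorm x ^+ 2).

Let gamma := alpha + theta.

Hypothesis Phi_step : forall s x, 1 <= s -> rad ^+ 2 < s ->
  let err := C * (s `^ (- (gamma + 1)) * gauss (a / 4) s x) in
  (forall rho, P rho ->
     expect rho (fun y => Phi (x + y, s)) <= Phi (x, s + 1) + err) /\
  (exists2 rho, P rho &
     Phi (x, s + 1) - err <= expect rho (fun y => Phi (x + y, s))).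

Let gamma0 : 0 < gamma. Proof. exact: addr_gt0. Qed.

Let enorm_scale x s : 0 < s -> enorm ((Num.sqrt s)^-1 *: x) ^+ 2 =
  enorm x ^+ 2 / s.
Proof.
move=> s0; rewrite enormZ exprMn mulrC; congr (_ * _).
by rewrite real_normK ?num_real// exprVn sqr_sqrtr// ltW.
Qed.

Let Phi_gt0 x s : 0 < s -> 0 < Phi (x, s).
Proof. by move=> s0; rewrite Phi_profile// mulr_gt0 ?powR_gt0. Qed.

Let Phi_le x s : 0 < s -> Phi (x, s) <= K * s `^ (- alpha) * gauss a s x.
Proof.
move=> s0; rewrite Phi_profile// mulrAC mulrC ler_wpM2r ?powR_ge0//.
by rewrite (le_trans (phi_le _))// enorm_scale// /gauss mulrA mulNr mulNr.
Qed.

Let powRN_le1 s (c : R) : 1 <= s -> 0 < c -> s `^ (- c) <= 1.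
Proof.
by move=> s1 c0; rewrite -[leRHS](powRr0 s) ler_powR// oppr_le0 ltW.
Qed.

Let Phi_leK x s : 1 <= s -> Phi (x, s) <= K.
Proof.
move=> s1; have s0 : 0 < s by rewrite (lt_le_trans ltr01).
rewrite (le_trans (Phi_le _ _))// -mulrA ler_piMr ?(ltW K0)//.
by rewrite mulr_ile1 ?powR_ge0 ?powRN_le1// ?gauss_le1 ?(ltW a0) ?(ltW s0)//
  ltW// gauss_gt0.
Qed.

Let Phi_ge (r c : R) x s : 0 <= r -> (forall z, enorm z <= r -> c <= phi z) ->
  0 < s -> enorm x ^+ 2 <= r ^+ 2 * s -> s `^ (- alpha) * c <= Phi (x, s).
Proof.
move=> r0 cphi s0 xr; rewrite Phi_profile// ler_wpM2l ?powR_ge0// cphi//.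
rewrite -(@ler_pXn2r _ 2) ?nnegrE ?enorm_ge0//.
by rewrite enorm_scale// ler_pdivrMr.
Qed.

Let Phi_cont s : 0 < s -> continuous (fun x => Phi (x, s)).
Proof.
move=> s0; rewrite (_ : (fun x => _) =
  (fun x => s `^ (- alpha) * phi ((Num.sqrt s)^-1 *: x))); last first.
  by apply/funext => x; rewrite Phi_profile.
have cz : continuous (fun x => phi ((Num.sqrt s)^-1 *: x)).
  move=> x; apply: (@continuous_comp _ _ _ (fun x => (Num.sqrt s)^-1 *: x)).
    exact: (cvgZ (cvg_cst _) cvg_id).
  exact: phi_cont.
by move=> x; exact: (cvgM (cvg_cst _) (cz x)).
Qed.

(** [b2] is the largest rate allowed in [expect_gauss_le]. The barriers use a smaller rate [b]: at
    most [a / 4], to dominate the error of [Phi_step], and at most [b2 / 2], to dominate at the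
    starting time the Gaussian of rate [b2] that bounds the value function. *)
Let b2 := (32 * (d%:R * rad) ^+ 2)^-1.
Let b := Num.min (a / 4) (b2 / 2).

Let dr_gt0 : 0 < (d%:R * rad) ^+ 2.
Proof. by rewrite exprn_gt0// mulr_gt0 ?ltr0n// (lt_le_trans ltr01). Qed.

Let b2_gt0 : 0 < b2.
Proof. by rewrite invr_gt0 mulr_gt0. Qed.

Let b2_le : 32 * b2 * (d%:R * rad) ^+ 2 <= 1.
Proof. by rewrite mulrAC divff// gt_eqF// mulr_gt0. Qed.

Let b_gt0 : 0 < b.
Proof. by rewrite lt_min !divr_gt0. Qed.

Let b_a : b <= a / 4.
Proof. by rewrite ge_min lexx. Qed.

Let b_b2 : b <= b2 / 2.
Proof. by rewrite ge_min lexx orbT. Qed.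

Let b_le : 32 * b * (d%:R * rad) ^+ 2 <= 1.
Proof.
rewrite (le_trans _ b2_le)// ler_wpM2r ?(ltW dr_gt0)// ler_wpM2l//.
by rewrite (le_trans b_b2)// ler_pdivrMr// ler_peMr ?ler1n// ltW.
Qed.

(** Solves [M * (2^-gamma / 2) = 2 * C], so that the gain in [powRN_succ_decay] covers twice the
    error of [Phi_step]. *)
Let M := 4 * C * 2 `^ gamma.

Let M_gt0 : 0 < M.
Proof. by rewrite mulr_gt0 ?powR_gt0// mulr_gt0. Qed.

(* For [|x|^2 >= r^2 s] the Gaussian alone pays for the error of [Phi_step];
   for [|x|^2 < r^2 s] the decrease of [s `^ (- theta)] pays for both. *)
Let absorb : exists2 B : R, 0 < B & forall s x, 1 <= s ->
  2 * (C * (s `^ (- (gamma + 1)) * gauss (a / 4) s x))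
  + M * (s `^ (- gamma) * (gauss b (s + 1) x * expR (- (b *
    enorm x ^+ 2 / (4 * s ^+ 2)))))
  <= B * (s `^ (- theta) - (s + 1) `^ (- theta)) * Phi (x, s + 1)
     + M * ((s + 1) `^ (- gamma) * gauss b (s + 1) x).
Proof.
(* Beyond [r sqrt s] the damping exponent [b |x|^2 / (4 s^2)] reaches the [(gamma + 1) / s] that
   [powRN_succ_decay] requires. *)
pose r := Num.sqrt (4 * (gamma + 1) / b).
have r2 : r ^+ 2 = 4 * (gamma + 1) / b.
  by rewrite sqr_sqrtr// divr_ge0 ?(ltW b_gt0)// mulr_ge0// addr_ge0// ltW.
have r0 : 0 <= r by exact: sqrtr_ge0.
have [c c0 cphi] := compact_pos_lbound r0 phi_cont phi_gt0.
(* Chosen to make [h6] an equality: the lower bound on the drift then equals the error of [Phi_step]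
   plus the loss of the Gaussian term. *)
pose B := (2 * C + M * gamma) * 4 * 2 `^ alpha / (theta * c).
have cg : 0 < 2 * C + M * gamma by rewrite addr_gt0 ?mulr_gt0.
exists B => [|s x s1].
  by rewrite divr_gt0 ?mulr_gt0 ?powR_gt0.
have s0 : 0 < s by rewrite (lt_le_trans ltr01).
have B0 : 0 < B by rewrite divr_gt0 ?mulr_gt0 ?powR_gt0.
set q := enorm x ^+ 2; have q0 : 0 <= q by exact: sqr_ge0.
set u := b * q / (4 * s ^+ 2).
set G := gauss b (s + 1) x.
have G0 : 0 < G by exact: gauss_gt0.
have G1 : G <= 1 by rewrite gauss_le1 ?(ltW b_gt0)//; lra.
set ga := gauss (a / 4) s x.
have gaG : ga <= G.
  apply: gauss_le; rewrite (@le_trans _ _ (b / s))//.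
    by rewrite ler_pM2l// lef_pV2 ?posrE//; lra.
  by rewrite ler_pM2r ?invr_gt0.
have p0 : 0 < s `^ (- (gamma + 1)) by rewrite powR_gt0.
have d0' : 0 <= s `^ (- theta) - (s + 1) `^ (- theta).
  have t01 : 0 < theta <= 1 by rewrite theta0.
  apply: le_trans (powRN_succ_ge s1 t01).
  by rewrite mulr_ge0 ?powR_ge0// divr_ge0// ltW.
have Phi0 := @Phi_gt0 x (s + 1) (addr_gt0 s0 ltr01).
have [xr|xr] := leP (r ^+ 2 * s) q.
  have us : (gamma + 1) / s <= u.
    move: xr; rewrite r2 /u => xr.
    rewrite ler_pdivlMr ?mulr_gt0 ?exprn_gt0//.
    rewrite [leLHS](_ : _ = b * (4 * (gamma + 1) / b * s)).
      by rewrite ler_pM2l.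
    by field; rewrite !gt_eqF.
  have := powRN_succ_decay s1 gamma0 us.
  have MC : M * (2 `^ (- gamma) / 2) = 2 * C.
    by rewrite /M powRN; field; rewrite gt_eqF ?powR_gt0.
  set e := expR (- u); set p1 := s `^ (- gamma); set p2 := (s + 1) `^ (- gamma).
  move: MC; set k := 2 `^ (- gamma) / 2 => MC.
  set pp := s `^ _ in p0 * => h.
  have h1 : M * (p1 * e - p2) * G <= - (2 * C * pp) * G.
    rewrite ler_wpM2r ?(ltW G0)// -MC -mulrA -mulrN.
    by rewrite ler_wpM2l ?(ltW M_gt0).
  have h2 : 2 * C * pp * ga <= 2 * C * pp * G.
    by rewrite ler_wpM2l// mulr_ge0 ?(ltW p0)// mulr_ge0// ltW.
  have h3 : 0 <= B * (s `^ (- theta) - (s + 1) `^ (- theta)) * Phi (x, s + 1).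
    by rewrite mulr_ge0 ?(ltW Phi0)// mulr_ge0// ltW.
  move: h1 h2 h3.
  move: (_ * Phi _) => w; move: (M) (C) (p1) (p2) (pp) (e) (G) (ga) => m c' u1
    u2 u3 u4 u5 u6.
  by move=> h1 h2 h3; lra.
have e1 : expR (- u) <= 1.
  rewrite -[leRHS]expR0 ler_expR oppr_le0.
  by rewrite divr_ge0 ?mulr_ge0 ?(ltW b_gt0) ?enorm_ge0 ?(ltW s0).
have ga1 : ga <= 1 := le_trans gaG G1.
have h1 := powRN_succ_le s1 gamma0.
have t01 : 0 < theta <= 1 by rewrite theta0.
have h2 := powRN_succ_ge s1 t01.
have h3 : (s + 1) `^ (- alpha) * c <= Phi (x, s + 1).
  apply: (@Phi_ge r) => //; first lra.
  by rewrite (le_trans (ltW xr))// ler_wpM2l ?sqr_ge0// lerDl.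
have h4 := powRN_double s1 alpha0.
have h5 : B * (theta / 4 * s `^ (- (theta + 1))) * (2 `^ (- alpha) *
  s `^ (- alpha) * c)
    <= B * (s `^ (- theta) - (s + 1) `^ (- theta)) * Phi (x, s + 1).
  rewrite ler_pM//.
  - by rewrite mulr_ge0 ?(ltW B0)// mulr_ge0 ?powR_ge0// divr_ge0// ltW.
  - by rewrite !mulr_ge0 ?powR_ge0// ltW.
  - by rewrite ler_wpM2l ?(ltW B0).
  - by rewrite (le_trans _ h3)// ler_wpM2r// ltW.
have h6 : B * (theta / 4 * s `^ (- (theta + 1))) * (2 `^ (- alpha) *
  s `^ (- alpha) * c)
    = (2 * C + M * gamma) * s `^ (- (gamma + 1)).
  rewrite (_ : s `^ (- (gamma + 1)) = s `^ (- (theta + 1)) * s `^ (- alpha));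
    last first.
    rewrite -powRD ?(gt_eqF s0) ?implybT//; congr powR; rewrite /gamma; ring.
  rewrite /B (powRN 2); have := @powR_gt0 R 2 alpha (ltr0Sn _ 1).
  move: (2 `^ alpha) (2 * C + _) (s `^ _) (s `^ _) => t1 t2 t3 t4 /gt_eqF t10.
  by field; rewrite t10 !gt_eqF.
have h7 : M * (s `^ (- gamma) * (G * expR (- u)) - (s + 1) `^ (- gamma) * G)
    <= M * (gamma * s `^ (- (gamma + 1))).
  rewrite ler_pM2l// (@le_trans _ _ ((s `^ (- gamma) - (s + 1) `^ (- gamma)) *
    G))//.
    by rewrite mulrBl lerB// ler_wpM2l ?powR_ge0// ler_piMr// ltW.
  rewrite (le_trans (ler_wpM2r (ltW G0) h1))// ler_piMr//.
  by rewrite mulr_ge0 ?powR_ge0// ltW.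
have h8 : 2 * (C * (s `^ (- (gamma + 1)) * ga)) <=
  2 * (C * s `^ (- (gamma + 1))).
  by rewrite ler_pM2l// ler_pM2l// ler_piMr// ltW.
rewrite h6 in h5; move: h5 h7 h8.
move: (_ * Phi _) (s `^ (- (gamma + 1))) (s `^ (- gamma)) ((s + 1) `^ (-
  gamma)) => w pp p1 p2.
move: (expR _) (G) (ga) (M) (gamma) => e g g' m ga'.
by move=> h5 h7 h8; lra.
Qed.

Let gauss_cont s : continuous (@gauss R d b s).
Proof. exact: gauss_continuous. Qed.

Let shift_cont (f : 'rV[R]_d -> R) x : continuous f ->
  continuous (fun y => f (x + y)).
Proof. exact: continuous_translate. Qed.

Let barrier_expect rho x s (p m : R) : P rho -> 0 < s ->
  expect rho (fun y => p * Phi (x + y, s) + m * gauss b s (x + y)) =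
  p * expect rho (fun y => Phi (x + y, s)) + m *
    expect rho (fun y => gauss b s (x + y)).
Proof.
move=> /PM[_ rhoM] s0.
have c1 := shift_cont (x := x) (@Phi_cont s s0).
have c2 := shift_cont (x := x) (@gauss_cont s).
rewrite (expect_add rhoM) ?(expect_scale rhoM)//.
  by move=> y; exact: (cvgM (cvg_cst _) (c1 y)).
by move=> y; exact: (cvgM (cvg_cst _) (c2 y)).
Qed.

Let barrier_cont s (p m : R) : 0 < s ->
  continuous (fun x => p * Phi (x, s) + m * gauss b s x).
Proof.
move=> s0 x; have c1 := @Phi_cont s s0 x; have c2 := @gauss_cont s x.
exact: (cvgD (cvgM (cvg_cst _) c1) (cvgM (cvg_cst _) c2)).
Qed.

(** A starting time after which the one-step estimates apply and the coefficients [1 -+ B n^-theta]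
    stay between 0 and 2; [X] leaves room for further lower bounds on it. *)
Let threshold (B X : R) : 0 < B -> exists2 n0 : nat, X <= n0%:R &
  forall n : nat, (n0 <= n)%N ->
    [/\ 1 <= n%:R :> R, rad ^+ 2 < n%:R & 0 <= B * n%:R `^ (- theta) <= 1].
Proof.
move=> B0; have [|n1 hn1] := @powRN_le_eps R theta B^-1 theta0.
  by rewrite invr_gt0.
exists (maxn (maxn n1 (Num.bound (rad ^+ 2)).+1) (Num.bound `|X|)).
  rewrite (le_trans (ler_norm _))// (le_trans (ltW (archi_boundP (normr_ge0
    _))))//.
  by rewrite ler_nat leq_maxr.
move=> n; rewrite geq_max => /andP[+ _]; rewrite geq_max => /andP[n1n rn];
  split.
- by rewrite ler1n (leq_trans _ rn).
- rewrite (lt_le_trans (archi_boundP (sqr_ge0 _)))// ler_nat.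
  exact: leq_trans (leqnSn _) rn.
- rewrite mulr_ge0 ?powR_ge0 ?(ltW B0)//=.
  by rewrite mulrC -ler_pdivlMr// mul1r hn1.
Qed.

Lemma value_le_Phi : exists A M' : R, exists n0 :
  nat, [/\ 0 < A, 0 < M' & forall (n : nat) x,
  (n0 <= n)%N -> value delta P n x <= A * (Phi (x,
    n%:R) + M' * n%:R `^ (- gamma))].
Proof.
have [B B0 hB] := absorb.
have [n0 _ nrad] := threshold 0 B0.
pose u (n : nat) x := (1 - B * n%:R `^ (- theta)) * Phi (x, n%:R) +
  (M * n%:R `^ (- gamma)) * gauss b n%:R x.
have [s1 _ _] := nrad n0 (leqnn _); have s0 :
  0 < n0%:R :> R by rewrite (lt_le_trans ltr01).
(* Scales the Gaussian term of the barrier at time [n0] to the prefactor in [value_le_gauss]. *)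
pose A := expR (b2 * delta ^+ 2) / (M * n0%:R `^ (- gamma)).
have m0 : 0 < M * n0%:R `^ (- gamma) by rewrite mulr_gt0// powR_gt0.
have A0 : 0 < A by rewrite divr_gt0 ?expR_gt0.
have main n x : (n0 <= n)%N -> value delta P n x <= A * u n x.
  elim: n x => [|n IH] x; first by rewrite leqn0 => /eqP n00; move: s1;
    rewrite n00 ler10.
  rewrite leq_eqVlt => /predU1P[<-|].
    have [_ _ /andP[_ Bn]] := nrad n0 (leqnn _).
    rewrite (le_trans (value_le_gauss delta P0 PM n0 x b2_gt0 b2_le))//.
    apply: (@le_trans _ _ (A * ((M * n0%:R `^ (- gamma)) * gauss b n0%:R x))).
      rewrite mulrA divfK ?gt_eqF// ler_pM2l ?expR_gt0//.
      (* The value function has rate [b2 / (n0 + 1)], the barrier [b / n0]; from [b <= b2 / 2] and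
         [n0 + 1 <= 2 * n0], the barrier is the wider Gaussian. *)
      apply: gauss_le; rewrite (@le_trans _ _ (b2 / 2 / n0%:R))//.
        by rewrite ler_pM2r ?invr_gt0.
      rewrite -mulrA ler_pM2l// -invfM lef_pV2 ?posrE ?ltr0n// ?mulr_gt0//.
      by rewrite -natr1; lra.
    rewrite ler_pM2l// /u lerDr mulr_ge0 ?subr_ge0//.
    exact: ltW (Phi_gt0 _ s0).
  rewrite ltnS => n0n; have [n1' nr /andP[Bn0 Bn]] := nrad n n0n.
  have np : 0 < n%:R :> R by rewrite (lt_le_trans ltr01).
  have p1 : 0 <= 1 - B * n%:R `^ (- theta) <= 1.
    by rewrite subr_ge0 Bn/= gerBl.
  have /andP[p10 p11] := p1.
  apply: (value_succ_le P0 (u := fun y => A * u n y) (C := A * (K + M))).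
  - by move=> y; exact: IH.
  - move=> y; rewrite ler_pM2l// /u lerD//.
      rewrite (le_trans _ (Phi_leK y n1'))// ler_piMl//.
      exact: ltW (Phi_gt0 _ np).
    rewrite -mulrA ler_piMr ?(ltW M_gt0)//.
    rewrite mulr_ile1 ?powR_ge0 ?powRN_le1// ?gauss_le1 ?(ltW b_gt0) ?(ltW
      np)//.
    exact: ltW (gauss_gt0 _ _ _).
  move=> rho Pr.
  rewrite (expect_scale (PM Pr).2); last exact: shift_cont (barrier_cont np).
  rewrite ler_pM2l// /u barrier_expect//.
  have [+ _] := Phi_step x n1' nr; move=> /(_ rho Pr) e1.
  have e2 := @expect_gauss_le R d rad rho x b n%:R (PM Pr) b_gt0 b_le n1'.
  have e3 := hB n%:R x n1'.
  rewrite -natr1.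
  have pm : 0 <= M * n%:R `^ (- gamma) by rewrite mulr_ge0 ?powR_ge0// ltW.
  apply: (le_trans (lerD (ler_wpM2l p10 e1) (ler_wpM2l pm e2))).
  set err := C * _ in e1 e3 *.
  have err0 : 0 <= err.
    by rewrite !mulr_ge0 ?powR_ge0 ?(ltW C0)// ltW// gauss_gt0.
  have e4 : (1 - B * n%:R `^ (- theta)) * err <= 2 * err.
    rewrite ler_wpM2r// (le_trans p11)//; lra.
  move: e3 e4; move: (err) (Phi _) (gauss _ _ _) (expR _) => u1 u2 u3 u4.
  move: (n%:R `^ (- theta)) ((n%:R + 1) `^ (- theta)) (n%:R `^ (- gamma))
    ((n%:R + 1) `^ (- gamma)) => v1 v2 v3 v4.
  move: (M) => m e3 e4; lra.
exists A, M, n0; split => // n x n0n; have [n1' _ /andP[Bn0 Bn]] := nrad n n0n.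
have np : 0 < n%:R :> R by rewrite (lt_le_trans ltr01).
rewrite (le_trans (main n x n0n))// ler_pM2l// /u lerD//.
  by rewrite ler_piMl ?(ltW (Phi_gt0 _ np))// gerBl.
rewrite ler_piMr ?gauss_le1 ?(ltW b_gt0) ?(ltW np)//.
by rewrite mulr_ge0 ?powR_ge0// ltW.
Qed.

Lemma value_ge_Phi : assumptionBi delta P ->
  exists A M' : R, exists n0 : nat, [/\ 0 < A, 0 < M' & forall (n : nat) x,
  (n0 <= n)%N -> A * (Phi (x, n%:R) - M' * n%:R `^ (- gamma)) <=
    value delta P n x].
Proof.
move=> hBi; have [B B0 hB] := absorb.
(* For [|x| >= r sqrt (n0 log n0)] this gives [a |x|^2 / (2 n0) >= (theta + 1) log n0]; since
   [b <= a / 4], the Gaussian of rate [a] is then below that of rate [b] by a factor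
   [n0^(- theta - 1)]. *)
pose r := Num.sqrt (2 * (theta + 1) / a).
have rr0 : 0 < 2 * (theta + 1) / a by rewrite divr_gt0// mulr_gt0// addr_gt0.
have r0 : 0 < r by rewrite sqrtr_gt0.
have r2 : r ^+ 2 = 2 * (theta + 1) / a by rewrite sqr_sqrtr// ltW.
have [N0 _ hN0] := hBi r r0.
(* The extra power [n0^-1] gained far out must beat the constant [2 * K / M], hence the second
   constraint on [n0]. *)
have [n0 Xn0 nrad] := threshold (Num.max N0 (2 * K / M)) B0.
have N0n0 : N0 <= n0%:R by rewrite (le_trans _ Xn0)// le_max lexx.
have KMn0 : 2 * K <= M * n0%:R.
  by rewrite [leRHS]mulrC -ler_pdivrMr// (le_trans _ Xn0)// le_max lexx orbT.
have [s1 _ /andP[Bn0 Bn1]] := nrad n0 (leqnn _).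
have s0 : 0 < n0%:R :> R by rewrite (lt_le_trans ltr01).
have := hN0 n0 N0n0; set c0 := inf _ => c00.
pose v (n : nat) x := (1 + B * n%:R `^ (- theta)) * Phi (x, n%:R) +
  (- (M * n%:R `^ (- gamma))) * gauss b n%:R x.
(* In the region of B(i) the barrier is at most [2 * Phi <= 2 * K], so this factor brings it below
   [c0]. *)
pose A := c0 / (2 * K).
have A0 : 0 < A by rewrite divr_gt0// mulr_gt0.
have lnn : 0 <= n0%:R * ln n0%:R :> R by rewrite mulr_ge0// ?ln_ge0// ltW.
have base x : A * v n0 x <= value delta P n0 x.
  have Pp := @Phi_gt0 x n0%:R s0.
  have gp := gauss_gt0 b n0%:R x.
  have mp : 0 < M * n0%:R `^ (- gamma) by rewrite mulr_gt0// powR_gt0.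
  have [xr|xr] := leP (enorm x) (r * Num.sqrt (n0%:R * ln n0%:R)).
    apply: (@le_trans _ _ c0); last first.
      apply: ge_inf; last by exists x.
      by exists 0 => _ [y _ <-]; exact: value_ge0.
    rewrite -[leRHS](@divfK _ (2 * K)) ?gt_eqF ?mulr_gt0// ler_pM2l//.
    rewrite /v mulNr lerBlDr (@le_trans _ _ (2 * K))//; last first.
      by rewrite lerDl mulr_ge0 ?(ltW mp)// ltW.
    rewrite ler_pM ?(ltW Pp) ?Phi_leK//; first by rewrite addr_ge0.
    by lra.
  (* Outside that region the Gaussian term outweighs [2 * Phi] and the barrier is nonpositive. *)
  apply: (@le_trans _ _ 0); last exact: value_ge0.
  rewrite pmulr_rle0// /v mulNr subr_le0.
  have q1 : r ^+ 2 * (n0%:R * ln n0%:R) <= enorm x ^+ 2.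
    rewrite -(sqr_sqrtr lnn) -exprMn ler_pXn2r ?nnegrE ?enorm_ge0 ?(ltW xr)//.
    by rewrite mulr_ge0 ?sqrtr_ge0// ltW.
  have g1 : gauss a n0%:R x <= gauss b n0%:R x * n0%:R `^ (- (theta + 1)).
    rewrite /gauss /powR gt_eqF// -expRD ler_expR.
    have q2 : 2 * (theta + 1) / a * ln n0%:R <= enorm x ^+ 2 / n0%:R.
      by rewrite -r2 ler_pdivlMr// -mulrA (mulrC (ln _)).
    have q3 : (theta + 1) * ln n0%:R <= a / 2 * (enorm x ^+ 2 / n0%:R).
      rewrite (le_trans _ (ler_wpM2l _ q2))//; last by rewrite divr_ge0// ltW.
      by rewrite le_eqVlt; apply/orP; left; apply/eqP; field; rewrite gt_eqF.
    have q0 : 0 <= enorm x ^+ 2 / n0%:R by rewrite divr_ge0 ?sqr_ge0// ltW.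
    have q4 : b * (enorm x ^+ 2 / n0%:R) <= a / 4 * (enorm x ^+ 2 / n0%:R).
      by rewrite ler_wpM2r.
    have q5 : 0 <= a * (enorm x ^+ 2 / n0%:R) by rewrite mulr_ge0// ltW.
    rewrite -[X in - X <= _]mulrA -[X in _ <= - X + _]mulrA.
    move: q3 q4 q5; move: (enorm x ^+ 2 / _) (ln _) (b) => t1 t2 t3 q3 q4 q5.
    by lra.
  rewrite (@le_trans _ _ (2 * (K * n0%:R `^ (- alpha) * (gauss b n0%:R x *
    n0%:R `^ (- (theta + 1))))))//.
    rewrite ler_pM ?(ltW Pp)//.
    - by rewrite addr_ge0.
    - by lra.
    - rewrite (le_trans (Phi_le _ s0))// ler_wpM2l// mulr_ge0 ?powR_ge0//.
      exact: ltW.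
  rewrite powR_neg1// [X in M * X](_ : _ = n0%:R `^ (- alpha) *
    n0%:R `^ (- theta)); last first.
    by rewrite /gamma opprD powRD// (gt_eqF s0) implybT.
  rewrite [leLHS](_ : _ = 2 * K / n0%:R * (n0%:R `^ (- alpha) *
    n0%:R `^ (- theta) * gauss b n0%:R x)); last first.
    by move: (gauss _ _ _) (_ `^ _) (_ `^ _) => t1 t2 t3; ring.
  rewrite -[leRHS]mulrA ler_pM2r ?mulr_gt0 ?powR_gt0//.
  by rewrite ler_pdivrMr.
have main n x : (n0 <= n)%N -> A * v n x <= value delta P n x.
  elim: n x => [|n IH] x.
    by rewrite leqn0 => /eqP n00; move: s1; rewrite n00 ler10.
  rewrite leq_eqVlt => /predU1P[<-|]; first exact: base.
  rewrite ltnS => n0n; have [n1' nr /andP[p0 p1]] := nrad n n0n.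
  have np : 0 < n%:R :> R by rewrite (lt_le_trans ltr01).
  have [_ [rho Pr e1]] := Phi_step x n1' nr.
  have vc : continuous (v n) by exact: barrier_cont np.
  have cu : continuous (fun y => A * v n y).
    by move=> y; exact: (cvgM (cvg_cst _) (vc y)).
  apply: le_trans (value_succ_ge P0 PM x Pr cu (fun y => IH y n0n)).
  rewrite (expect_scale (PM Pr).2); last exact: shift_cont vc.
  rewrite ler_pM2l// /v barrier_expect//.
  have e2 := @expect_gauss_le R d rad rho x b n%:R (PM Pr) b_gt0 b_le n1'.
  have e3 := hB n%:R x n1'.
  have q0 : 0 <= 1 + B * n%:R `^ (- theta) by rewrite addr_ge0.
  have pm : 0 <= M * n%:R `^ (- gamma) by rewrite mulr_ge0 ?powR_ge0// ltW.
  rewrite -natr1 mulNr [leRHS]addrC mulNr addrC -lerBlDr opprK.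
  have e1' := ler_wpM2l q0 e1; have e2' := ler_wpM2l pm e2.
  set err := C * _ in e1 e1' e3.
  have err0 : 0 <= err.
    rewrite mulr_ge0 ?(ltW C0)// mulr_ge0 ?powR_ge0//.
    exact: ltW (gauss_gt0 _ _ _).
  (* The coefficient of [Phi] can reach 2, whence the factor 2 on the error in [absorb]. *)
  have e4 : (1 + B * n%:R `^ (- theta)) * err <= 2 * err.
    by rewrite ler_wpM2r//; lra.
  move: e1' e2' e3 e4; move: (expect _ _) (expect _ _) (err) (Phi _) (gauss b _
    _) (expR _) => w1 w2 u1 u2 u3 u4.
  move: (n%:R `^ (- theta)) ((n%:R + 1) `^ (- theta)) (n%:R `^ (- gamma))
    ((n%:R + 1) `^ (- gamma)) => v1 v2 v3 v4.
  move: (M) => m e1' e2' e3 e4; lra.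
exists A, M, n0; split => // n x n0n; have [n1' _ /andP[p0 p1]] := nrad n n0n.
have np : 0 < n%:R :> R by rewrite (lt_le_trans ltr01).
apply: le_trans (main n x n0n); rewrite ler_pM2l// /v lerD//.
  by rewrite ler_peMl ?(ltW (Phi_gt0 _ np))// lerDl.
rewrite mulNr lerN2 ler_piMr ?gauss_le1 ?(ltW b_gt0) ?(ltW np)//.
by rewrite mulr_ge0 ?powR_ge0// ltW.
Qed.

Lemma Phi_local_lbound (r : R) : 0 < r -> exists2 c : R, 0 < c &
  forall (n : nat) x, (0 < n)%N -> eball 0 (r * Num.sqrt n%:R) x ->
    n%:R `^ (- alpha) * c <= Phi (x, n%:R).
Proof.
move=> r0; have [c c0 cphi] := compact_pos_lbound (ltW r0) phi_cont phi_gt0.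
exists c => // n x n0; rewrite /eball/= subr0 => xr.
have np : 0 < n%:R :> R by rewrite ltr0n.
apply: (Phi_ge (ltW r0) cphi np).
rewrite -[X in _ * X](sqr_sqrtr (ltW np)) -exprMn.
by rewrite ler_pXn2r ?nnegrE ?enorm_ge0 ?(ltW xr)// mulr_ge0 ?sqrtr_ge0// ltW.
Qed.

(* In [B_(r sqrt n)] the Gaussian corrections are [O(n^-theta) Phi], with a
   constant that depends on [r] and only affects the rank from which they are
   negligible. *)
Let correction_le (r M' e : R) : 0 < r -> 0 < M' -> 0 < e -> exists n0 : nat,
  forall (n : nat) x, (n0 <= n)%N -> eball 0 (r * Num.sqrt n%:R) x ->
    0 < Phi (x, n%:R) /\ M' * n%:R `^ (- gamma) <= e * Phi (x, n%:R).
Proof.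
move=> r0 M0 e0; have [c c0 cPhi] := Phi_local_lbound r0.
have [|n1 hn1] := @powRN_le_eps R theta (e * c / M') theta0.
  by rewrite divr_gt0// mulr_gt0.
exists (maxn n1 1) => n x; rewrite geq_max => /andP[n1n n0] xr.
have np : 0 < n%:R :> R by rewrite ltr0n.
split; first exact: Phi_gt0.
apply: (@le_trans _ _ (e * (n%:R `^ (- alpha) * c))); last first.
  by rewrite ler_pM2l// cPhi.
rewrite /gamma opprD powRD ?(gt_eqF np) ?implybT// mulrCA [leRHS]mulrCA.
rewrite ler_wpM2l ?powR_ge0// mulrC -ler_pdivlMr//.
exact: hn1.
Qed.

Lemma limsup_ratio_bounded :
  (ereal_sup [set limn_esup (fun n : nat =>
        ereal_sup [set (value delta P n x / Phi (x, n%:R))%:E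
                  | x in eball (0%R : 'rV[R]_d) (r * Num.sqrt n%:R)%R])
      | r in [set r : R | (0 < r)%R]] < +oo)%E.
Proof.
have [A [M' [n0 [A0 M0 hA]]]] := value_le_Phi.
apply: (@le_lt_trans _ _ (A * 2)%:E); last exact: ltry.
apply: ge_ereal_sup => _ [r r0 <-].
(* The bound [A * 2] is fixed before [r]; only the rank [n1] depends on [r]. *)
have [n1 hn1] := correction_le r0 M0 ltr01.
apply: (@limn_esup_le _ _ (maxn n0 n1)) => n; rewrite geq_max => /andP[n0n n1n].
apply: ge_ereal_sup => _ [x xr <-]; rewrite lee_fin.
have [Pp cor] := hn1 n x n1n xr.
rewrite ler_pdivrMr// (le_trans (hA n x n0n))// -mulrA ler_pM2l//.
by move: cor; rewrite mul1r; lra.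
Qed.

Lemma liminf_ratio_pos : assumptionBi delta P ->
  (0 < ereal_inf [set limn_einf (fun n : nat =>
        ereal_inf [set (value delta P n x / Phi (x, n%:R))%:E
                  | x in eball (0%R : 'rV[R]_d) (r * Num.sqrt n%:R)%R])
      | r in [set r : R | (0 < r)%R]])%E.
Proof.
move=> hBi; have [A [M' [n0 [A0 M0 hA]]]] := value_ge_Phi hBi.
apply: (@lt_le_trans _ _ (A / 2)%:E); first by rewrite lte_fin divr_gt0.
apply: le_ereal_inf_tmp => _ [r r0 <-].
(* With tolerance [1/2], half of [Phi] survives the correction for every [r], which gives
   [A / 2]. *)
have [|n1 hn1] := @correction_le r M' 2^-1 r0 M0; first by rewrite invr_gt0.
apply: (@limn_einf_ge _ _ (maxn n0 n1)) => n; rewrite geq_max => /andP[n0n n1n].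
apply: le_ereal_inf_tmp => _ [x xr <-]; rewrite lee_fin.
have [Pp cor] := hn1 n x n1n xr.
rewrite ler_pdivlMr// (le_trans _ (hA n x n0n))// -mulrA ler_pM2l//.
by lra.
Qed.

End Barriers.

(** * Both ratio bounds from Assumption A *)

Theorem theorem2p7 (R : realType) (d : nat) (rad delta : R)
    (P : set (Prob R d)) (Phi : 'rV[R]_d * R -> R) :
  (1 <= d)%N -> 1 <= rad -> 0 < delta ->
  P !=set0 -> P `<=` Mset rad -> weak_borel P ->
  assumptionA P Phi ->
  (assumptionBii delta P ->
   (ereal_sup [set limn_esup (fun n : nat =>
        ereal_sup [set (value delta P n x / Phi (x, n%:R))%:E
                  | x in eball (0%R : 'rV[R]_d) (r * Num.sqrt n%:R)%R])
      | r in [set r : R | (0 < r)%R]] < +oo)%E) /\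
  (assumptionBi delta P ->
   (0 < ereal_inf [set limn_einf (fun n : nat =>
        ereal_inf [set (value delta P n x / Phi (x, n%:R))%:E
                  | x in eball (0%R : 'rV[R]_d) (r * Num.sqrt n%:R)%R])
      | r in [set r : R | (0 < r)%R]])%E).

Proof.
move=> d1 rad1 _ P0 PM _ [alpha [sigma [a [K [[al0 /andP[s0 s1] a0 K1]]]]]].
move=> [[C2 pde Pp sc] [c2 _ nm]].
have K0 : 0 < K by rewrite (lt_trans ltr01).
have [C C0 st] := Phi_step d1 rad1 P0 PM al0 s0 s1 a0 K0 C2 pde sc c2 nm.
have pr x (t : R) : 0 < t -> Phi (x, t) = t `^ (- alpha) *
  Phi ((Num.sqrt t)^-1 *: x, 1).
  exact: Phi_profile.
have pc := profile_continuous c2.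
have p0 x : 0 < Phi (x, 1) by exact: Pp.
have pl x : Phi (x, 1) <= K * expR (- a * enorm x ^+ 2).
  exact: le_trans (ler_norm _) (profile_le d1 s0 K0 nm x).
have t0 : 0 < sigma / 2 by rewrite divr_gt0.
have t1 : sigma / 2 <= 1 by lra.
split=> [_|].
  exact: (@limsup_ratio_bounded _ _ rad delta P Phi alpha (sigma / 2) a K C).
exact: (@liminf_ratio_pos _ _ rad delta P Phi alpha (sigma / 2) a K C).
Qed.
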